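(* Let $q$ be a prime power, $m,t\ge 2$ integers with $m$ not divisible by the characteristic of $\mathbb{F}_q$, and $f(x)=(x-\alpha_1)\cdots(x-\alpha_t)\in\mathbb{F}_q[x]$, where $\alpha_1,\dots,\alpha_t\in\mathbb{F}_q$ are pairwise distinct. Let $\mathcal{X}$ be the curve $y^m=f(x)$ with function field $\mathbb{F}_q(\mathcal{X})$. Let $n\le t$ be an integer with $2\le n\le q$, let $Q_1,\dots,Q_n$ be pairwise distinct places of $\mathbb{F}_q(\mathcal{X})$ corresponding to zeros of $f(x)$, and let $\mathbf{Q}=(Q_1,\dots,Q_n)$. Let $\Upsilon$ denote either $\Gamma$ or $\Lambda$, and let $\rho=0$ if $\Upsilon=\Gamma$ and $\rho=n-2$ if $\Upsilon=\Lambda$. Then $$\widehat{\Upsilon}(\mathbf{Q})=\left\{(mj_1+i,\dots,mj_n+i): 1\le i\le m-1,\ j_1,\dots,j_n\in\mathbb{Z},\ j_1+\cdots+j_n=t-n-\lfloor it/m\rfloor+\rho\right\}$$ $$\cup\ \left\{(mj_1,\dots,mj_n): j_1,\dots,j_n\in\mathbb{Z},\ j_1+\cdots+j_n=\rho\right\}.$$ In particular, $$\Upsilon(\mathbf{Q})=\left\{(mj_1+i,\dots,mj_n+i): 1\le i\le m-1,\ j_1,\dots,j_n\in\mathbb{N}_0,\ j_1+\cdots+j_n=t-n-\lfloor it/m\rfloor+\rho\right\}.$$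
   Context: $\mathbb{N}$ is the set of positive integers and $\mathbb{N}_0=\mathbb{N}\cup\{0\}$. $\nu_P$ is the discrete valuation at a place $P$. The place of $\mathbb{F}_q(\mathcal{X})$ corresponding to a zero $\alpha_k$ of $f(x)$ is the unique place lying over the zero of $x-\alpha_k$ in $\mathbb{F}_q(x)$ (which is totally ramified in $\mathbb{F}_q(\mathcal{X})/\mathbb{F}_q(x)$). Let $F/\mathbb{F}_q$ be a function field and $\mathbf{Q}=(Q_1,\dots,Q_n)$ an $n$-tuple of distinct rational places. Let $R_{\mathbf{Q}}$ be the ring of functions in $F$ regular outside $\{Q_1,\dots,Q_n\}$. The generalized Weierstrass semigroup is $$\widehat{H}(\mathbf{Q})=\{(-\nu_{Q_1}(z),\dots,-\nu_{Q_n}(z))\in\mathbb{Z}^n : z\in R_{\mathbf{Q}}\setminus\{0\}\}.$$ Let $I=\{1,\dots,n\}$. For a nonempty $J\subsetneq I$ and $\alpha\in\mathbb{Z}^n$ let $$\nabla_J(\alpha)=\{\beta\in\widehat{H}(\mathbf{Q}) : \beta_j=\alpha_j \text{ for } j\in J,\ \beta_i<\alpha_i \text{ for } i\notin J\},\qquad \nabla(\alpha)=\bigcup_{i=1}^n\nabla_{\{i\}}(\alpha).$$ An element $\alpha\in\widehat{H}(\mathbf{Q})$ is maximal if $\nabla(\alpha)=\emptyset$. It is absolute maximal if it is maximal and $\nabla_J(\alpha)=\emptyset$ for every $J\subsetneq I$ with $|J|\ge 2$; it is relative maximal if it is maximal and $\nabla_J(\alpha)\ne\emptyset$ for every $J\subsetneq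 I$ with $|J|\ge2$. $\widehat{\Gamma}(\mathbf{Q})$ and $\widehat{\Lambda}(\mathbf{Q})$ denote the sets of absolute maximal and relative maximal elements of $\widehat{H}(\mathbf{Q})$, respectively, and $$\Gamma(\mathbf{Q})=\widehat{\Gamma}(\mathbf{Q})\cap\mathbb{N}^n,\qquad \Lambda(\mathbf{Q})=\widehat{\Lambda}(\mathbf{Q})\cap\mathbb{N}^n.$$ *)

(* Defs.v *)
From HB Require Import structures.
From mathcomp Require Import all_boot all_order all_algebra all_field.
From mathcomp Require Import boolp classical_sets.

Set Implicit Arguments.
Unset Strict Implicit.
Unset Printing Implicit Defensive.

Import Order.TTheory GRing.Theory Num.Theory.

Local Open Scope classical_set_scope.
Local Open Scope ring_scope.

(* [F] is a field with constants embedded by [iota : k -> F].  A place is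
   recorded by its valuation ring [O] with [k < O < F]; the place itself, in the
   sense of the maximal ideal of [O], is [max_ideal].  The two determine each
   other, so equality of [place]s is equality of places (by extensionality and
   proof irrelevance). *)
Record place (k F : fieldType) (iota : {rmorphism k -> F}) := Place {
  val_ring : set F;
  val_ring1 : val_ring 1;
  val_ringB : forall u v, val_ring u -> val_ring v -> val_ring (u - v);
  val_ringM : forall u v, val_ring u -> val_ring v -> val_ring (u * v);
  val_ring_const : range iota `<` val_ring;
  val_ring_proper : val_ring `<` setT;
  val_ring_total : forall z, val_ring z \/ val_ring z^-1
}.

Section Valuation.
Variables (k F : fieldType) (iota : {rmorphism k -> F}).
Implicit Types (P : place iota) (z t u : F).

Definition val_unit P : set F := [set z | [/\ z != 0, val_ring P z & val_ring P z^-1]].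

Definition max_ideal P : set F := [set z | val_ring P z /\ ~ val_unit P z].

Definition prime_element P t : Prop := max_ideal P = [set t * u | u in val_ring P].

(* [nu P z] is the [e] such that [z = t ^ e * u] with [t] a prime element and
   [u] a unit.  It is meaningful for [z != 0] when [max_ideal P] is principal,
   which holds for every place of a function field, so the default value 0 of
   [xget] is not used there. *)
Definition nu P z : int :=
  xget 0 [set e : int | exists t u,
            [/\ prime_element P t, val_unit P u & z = t ^ e * u]].

End Valuation.

Section WeierstrassSemigroup.
Variables (k F : fieldType) (iota : {rmorphism k -> F}).
Variables (n : nat) (Q : 'I_n -> place iota).
Implicit Types (a b : {ffun 'I_n -> int}) (J : {set 'I_n}).

Definition regular_outside : set F :=
  [set z | forall P : place iota, (forall l, P <> Q l) -> val_ring P z].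

Definition Hhat : set {ffun 'I_n -> int} :=
  [set a | exists z, [/\ regular_outside z, z != 0 &
                         a = [ffun l => - nu (Q l) z]]].

Definition nablaJ J a : set {ffun 'I_n -> int} :=
  [set b | [/\ Hhat b, forall j, j \in J -> b j = a j &
               forall i, i \notin J -> b i < a i]].

Definition nabla a : set {ffun 'I_n -> int} :=
  [set b | exists i, nablaJ [set i]%SET a b].

Definition maximal a : Prop := Hhat a /\ nabla a = set0.

Definition Gamma_hat : set {ffun 'I_n -> int} :=
  [set a | maximal a /\
           forall J, J \proper [set: 'I_n]%SET -> (2 <= #|J|)%N ->
             nablaJ J a = set0].

Definition Lambda_hat : set {ffun 'I_n -> int} :=
  [set a | maximal a /\
           forall J, J \proper [set: 'I_n]%SET -> (2 <= #|J|)%N ->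
             nablaJ J a !=set0].

Definition positive_vectors : set {ffun 'I_n -> int} :=
  [set a | forall l, 0 < a l].

Definition Gamma := Gamma_hat `&` positive_vectors.

Definition Lambda := Lambda_hat `&` positive_vectors.

End WeierstrassSemigroup.

Section Kummer.
Variable k : fieldType.

Definition ratfun_const : {rmorphism k -> {fraction {poly k}}} :=
  @tofrac {poly k} \o polyC.

Variable L : fieldExtType {fraction {poly k}}.

Definition curve_const : {rmorphism k -> L} := in_alg L \o ratfun_const.

(* [L = k(x)(y)] with [y ^ m = f(x)].  This is the function field of the curve
   [y ^ m = f(x)] when [Y ^ m - f(x)] is irreducible over [k(x)], which is the
   case as soon as [f] has a simple root in [k] (Eisenstein's criterion). *)
Definition curve_function_field (m : nat) (f : {poly k}) (y : L) : Prop :=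
  y ^+ m = (tofrac f)%:A /\ <<1; y>>%VS = fullv.

(* [P'] lies over [P], where [P] is a place of [k(x)]. *)
Definition lies_over (P' : place curve_const) (P : place ratfun_const) : Prop :=
  forall z, max_ideal P z -> max_ideal P' z%:A.

(* [P'] lies over the zero of [x - r] in [k(x)]. *)
Definition over_zero (P' : place curve_const) (r : k) : Prop :=
  exists2 P : place ratfun_const,
    max_ideal P (tofrac ('X - r%:P)) & lies_over P' P.

End Kummer.

(* Main.v *)
(* Every z in the function field is uniquely a sum of components a_i(x) y^i with
   0 <= i < m.  At a place Q over a root r of f, y is a uniformizer and a_i y^i
   has order m ord_r(a_i) + i, so the orders of the components are pairwise
   distinct and the order of z is the least of them.  Moreover z is regular
   outside Q_1, ..., Q_n iff each component is: after adjoining the m-th roots of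
   unity, the components are averages of the conjugates of z.  The power
   (a_i y^i)^m = a_i^m f^i is a rational function, for which regularity means
   that a_i has poles only at the Q_l and i t + m sum_l ord_(Q_l)(a_i) <= 0.
   Hence b lies in the semigroup iff, for every residue i of some -b_l modulo m,
   the integers floor((b_l + i) / m) have sum G_i at least C_i, the ceiling of
   i t / m.  Lowering the coordinates outside J lowers G_i by the number of l
   outside J with -b_l = i modulo m.  Therefore a maximal element that is absolute
   or relative has a single residue i, with G_i = C_i in the absolute case and
   G_i = C_i + n - 2 in the relative case. *)
Require Import Defs.
From HB Require Import structures.
From mathcomp Require Import all_boot all_order all_algebra all_field.
From mathcomp Require Import generic_quotient cyclic boolp classical_sets ring zify.

Set Implicit Arguments.
Unset Strict Implicit.
Unset Printing Implicit Defensive.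

Import Order.TTheory GRing.Theory Num.Theory.

Local Open Scope classical_set_scope.
Local Open Scope ring_scope.

(** * Splitting fields and primitive roots of unity *)

Lemma irreducible_factor (F : fieldType) (p : {poly F}) :
  (1 < size p)%N -> exists2 q, irreducible_poly q & q %| p.
Proof.
have [n] := ubnP (size p); elim: n p => // n IHn p ltpn p_gt1.
have [irr_p|] := pselect (irreducible_poly p); first by exists p.
move=> red_p; have p_neq0 : p != 0 by rewrite -size_poly_gt0 (ltn_trans _ p_gt1).
have [q [q_neq1 dvd_qp neq_qp]] :
    exists q : {poly F}, [/\ size q != 1%N, q %| p & ~~ (q %= p)].
  apply: contrapT => no_q; apply: red_p; split=> // q q_neq1 dvd_qp.
  by apply/negPn/negP => neq_qp; apply: no_q; exists q.
have q_neq0 : q != 0 by apply: contraTneq dvd_qp => ->; rewrite dvd0p.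
have lt_qp : (size q < size p)%N.
  by rewrite ltn_neqAle dvdp_leq // andbT; move: neq_qp; rewrite -dvdp_size_eqp.
have q_gt1 : (1 < size q)%N by rewrite ltn_neqAle eq_sym q_neq1 size_poly_gt0.
have [r irr_r dvd_rq] := IHn q (leq_trans lt_qp ltpn) q_gt1.
by exists r => //; apply: dvdp_trans dvd_qp.
Qed.

(** Induction on the size of [p], over all fields at once: adjoining a root [z] of an irreducible
    factor splits off a linear factor, and the quotient is handled over the larger field. *)
Lemma exists_splitting_field (F : fieldType) (p : {poly F}) : p != 0 ->
  exists (E : fieldType) (h : {rmorphism F -> E}) (rs : seq E),
    map_poly h p %= \prod_(r <- rs) ('X - r%:P).
Proof.
have [n] := ubnP (size p); elim: n F p => // n IHn F p ltpn p_neq0.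
have [p_gt1|p_le1] := ltnP 1 (size p); last first.
  exists F, idfun, [::]; rewrite big_nil map_poly_id // -size_poly_eq1.
  by rewrite eqn_leq p_le1 size_poly_gt0.
have [q irr_q dvd_qp] := irreducible_factor p_gt1.
have [L _ [z qz0 _]] := irredp_FAdjoin irr_q.
have pz0 : root (map_poly (in_alg L) p) z.
  by rewrite -(divpK dvd_qp) rmorphM rootM qz0 orbT.
have [p1 def_p] := factor_theorem _ _ pz0.
have p1_neq0 : p1 != 0.
  by apply: contraNneq p_neq0 => p10; rewrite -(map_poly_eq0 (in_alg L)) def_p p10 mul0r.
have [] := IHn L p1 _ p1_neq0.
  rewrite -(size_map_poly (in_alg L)) def_p size_Mmonic ?monicXsubC // in ltpn.
  by move: ltpn; rewrite size_XsubC addn2 /= ltnS.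
move=> E [h [rs def_p1]]; exists E, (h \o in_alg L), (h z :: rs).
rewrite big_cons map_poly_comp [map_poly (in_alg L) p]def_p rmorphM /= mulrC.
by rewrite rmorphB /= map_polyX map_polyC /= eqp_mul2l ?polyXsubC_eq0.
Qed.

(** As [m] is nonzero in [F], [X^m - 1] is separable and has [m] distinct roots in a splitting
    field; a field with [m] distinct [m]-th roots of unity contains a primitive one. *)
Lemma exists_primitive_root (F : fieldType) (m : nat) : m%:R != 0 :> F ->
  exists (E : fieldType) (h : {rmorphism F -> E}) (w : E), m.-primitive_root w.
Proof.
move=> m_neq0; have m_gt0 : (0 < m)%N by case: m m_neq0 => //; rewrite eqxx.
have Xm1_neq0 : ('X^m - 1 : {poly F}) != 0.
  by rewrite -size_poly_gt0 size_XnsubC.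
have [E [h [rs def_rs]]] := exists_splitting_field Xm1_neq0.
exists E, h; rewrite rmorphB rmorph1 /= map_polyXn in def_rs.
have mE_neq0 : m%:R != 0 :> E by rewrite -(rmorph_nat h) fmorph_eq0.
have Urs : uniq rs.
  by rewrite -separable_prod_XsubC -(eqp_separable def_rs) separable_Xn_sub_1.
have /hasP[w _ prim_w] : has m.-primitive_root rs.
  apply: has_prim_root => //.
    apply/allP=> r; rewrite -root_prod_XsubC -(eqp_root def_rs).
    by rewrite unity_rootE rootE !hornerE subr_eq0.
  move/eqp_size: def_rs; rewrite size_XnsubC // size_prod_XsubC.
  by move=> [->].
by exists w.
Qed.

(** * Existence of valuation rings *)

Section Subrings.
Variable F : fieldType.
Implicit Types (A B O : set F) (u v w x z : F) (p q : {poly F}).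

Definition subring A := [/\ A 1, forall u v, A u -> A v -> A (u - v) &
  forall u v, A u -> A v -> A (u * v)].

(** The whole field qualifies; properness is supplied separately when a place is built. *)
Definition valring O := subring O /\ forall z, O z \/ O z^-1.

Section Closure.
Variable A : set F.
Hypothesis subA : subring A.

Lemma subring1 : A 1. Proof. by case: subA. Qed.
Lemma subringB u v : A u -> A v -> A (u - v). Proof. by case: subA => _ + _; apply. Qed.
Lemma subringM u v : A u -> A v -> A (u * v). Proof. by case: subA => _ _; apply. Qed.
Lemma subring0 : A 0. Proof. by rewrite -(subrr 1); apply: subringB; apply: subring1. Qed.
Lemma subringN u : A u -> A (- u).
Proof. by rewrite -sub0r; apply: subringB subring0. Qed.
Lemma subringD u v : A u -> A v -> A (u + v).
Proof. by move=> Au /subringN Av; rewrite -[v]opprK; apply: subringB. Qed.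
Lemma subringX u n : A u -> A (u ^+ n).
Proof.
move=> Au; elim: n => [|n IHn]; first by rewrite expr0; exact: subring1.
by rewrite exprS; apply: subringM.
Qed.
Lemma subring_sum (I : Type) (r : seq I) (P : pred I) (f : I -> F) :
  (forall i, P i -> A (f i)) -> A (\sum_(i <- r | P i) f i).
Proof. by move=> Af; elim/big_ind: _ => //; [exact: subring0|exact: subringD]. Qed.
Lemma subring_prod (I : Type) (r : seq I) (P : pred I) (f : I -> F) :
  (forall i, P i -> A (f i)) -> A (\prod_(i <- r | P i) f i).
Proof. by move=> Af; elim/big_ind: _ => //; [exact: subring1|exact: subringM]. Qed.
Definition adjoin x := [set z | exists2 p : {poly F}, (forall i, A p`_i) & z = p.[x]].

Lemma subring_adjoin x : subring (adjoin x).
Proof.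
split.
- exists 1; last by rewrite hornerC.
  by move=> i; rewrite coef1; case: (i == _)%N; [exact: subring1|exact: subring0].
- move=> _ _ [p Ap ->] [q Aq ->]; exists (p - q); last by rewrite !hornerE.
  by move=> i; rewrite coefB; apply: subringB.
- move=> _ _ [p Ap ->] [q Aq ->]; exists (p * q); last by rewrite !hornerE.
  by move=> i; rewrite coefM; apply: subring_sum => j _; apply: subringM.
Qed.

Lemma sub_adjoin x : A `<=` adjoin x.
Proof.
move=> u Au; exists u%:P; last by rewrite hornerC.
by move=> i; rewrite coefC; case: eqP => // _; exact: subring0.
Qed.

Lemma mem_adjoin x : adjoin x x.
Proof.
exists 'X; last by rewrite hornerX.
by move=> i; rewrite coefX; case: eqP => _; [exact: subring1|exact: subring0].
Qed.

End Closure.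

(* A subring that is maximal among those containing [v] but not its inverse is
   a valuation ring: [1 - v * a] is always a unit in it, so relations
   [v^-1 = p.[x]] and [v^-1 = q.[x^-1]] shorten each other. *)
Section MaximalSubring.
Variables (A : set F) (v : F).
Hypotheses (subA : subring A) (Av : A v) (notAv : ~ A v^-1).
Hypothesis maxA : forall x, ~ A x -> adjoin A x v^-1.

Let v_neq0 : v != 0.
Proof. by apply/eqP=> v0; apply: notAv; rewrite v0 invr0; apply: subring0. Qed.

(** If [s = 1 - v * a] had no inverse in [A], maximality would give [v^-1] as a polynomial in
    [s^-1]. Multiplying by a high power of [s], which has the form [1 - v * b], puts [v^-1 - b] and
    hence [v^-1] in [A]. *)
Lemma maximal_subring_unit a : A a -> 1 - v * a != 0 /\ A (1 - v * a)^-1.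
Proof.
move=> Aa; set s := 1 - v * a.
have s_neq0 : s != 0.
  rewrite subr_eq0; apply/eqP=> va1; apply: notAv.
  by rewrite -[v^-1]mulr1 va1 mulrA mulVf // mul1r.
split=> //; have As : A s.
  by apply: subringB => //; [apply: subring1|apply: subringM].
have expsE n : exists2 b, A b & s ^+ n = 1 - v * b.
  elim: n => [|n [b Ab IHn]].
    by exists 0; [exact: subring0|rewrite mulr0 subr0 expr0].
  exists (a + b - v * a * b); last first.
    rewrite exprS IHn /s mulrBr mulr1 mulrBl mul1r !mulrBr !mulrDr.
    by rewrite !opprB !opprD !mulrA addrACA [v * a * v]mulrAC -!addrA; congr (_ + (_ + (_ + _))).
  apply: subringB => //; first exact: subringD.
  by do 2?apply: subringM.
apply: contrapT => /maxA[p Ap def_v].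
have [b Ab sE] := expsE (size p).
apply: notAv; rewrite -[v^-1](subrK b); apply: subringD => //.
suff -> : v^-1 - b = v^-1 * s ^+ size p.
  rewrite def_v horner_coef mulr_suml; apply: subring_sum => // i _.
  rewrite -mulrA; suff -> : s^-1 ^+ i * s ^+ size p = s ^+ (size p - i).
    by apply: subringM => //; apply: subringX.
  have si_neq0 := expf_neq0 i s_neq0; apply: (mulfI si_neq0).
  by rewrite exprVn mulVKf // -exprD subnKC // ltnW.
by rewrite sE mulrBr mulr1 mulrA mulVf // mul1r.
Qed.

Lemma maximal_subring_relation x p q : (forall i, A p`_i) -> (forall i, A q`_i) ->
  x != 0 -> v^-1 = p.[x] -> v^-1 = q.[x^-1] -> False.
Proof.
have [n] := ubnP (size p + size q); elim: n x p q => // n IHn x p q ltn Ap Aq x_neq0 vp vq.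
wlog le_qp : x p q ltn Ap Aq x_neq0 vp vq / (size q <= size p)%N.
  move=> H; have [|/ltnW le_pq] := leqP (size q) (size p); first exact: (H x p q).
  by apply: (H x^-1 q p); rewrite ?invr_eq0 ?invrK // addnC.
have p_gt0 : (0 < size p)%N.
  rewrite lt0n; apply/negP => /eqP/size0nil/eqP; rewrite -/(nilp _).
  move=> /eqP p0; apply: notAv; rewrite vp horner_coef.
  by rewrite p0 /= big_ord0; apply: subring0.
have [u_neq0 Au] := maximal_subring_unit (Aq 0%N).
set u := 1 - v * q`_0 in u_neq0 Au; set d := (size p).-1.
have sz_p : size p = d.+1 by rewrite prednK.
(* Multiplying the relation in [x^-1] by [v], isolating its constant term and dividing by the unit
   [u] writes 1 as a combination of negative powers of [x] with coefficients [c j]. *)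
pose c j := v * q`_j / u.
have Ac j : A (c j) by do 2?apply: subringM.
have c1 : \sum_(j < d) c j.+1 * x^-1 ^+ j.+1 = 1.
  apply: (mulfI u_neq0); rewrite mulr1 mulr_sumr.
  transitivity (\sum_(j < d) v * (q`_j.+1 * x^-1 ^+ j.+1)).
    by apply: eq_bigr => j _; rewrite /c mulrA mulrCA divff // mulr1 mulrA.
  rewrite -mulr_sumr /u; have := vq.
  rewrite (@horner_coef_wide _ d.+1); last by rewrite -sz_p.
  rewrite big_ord_recl expr0 mulr1 => vE.
  apply/eqP; rewrite eq_sym subr_eq addrC -mulrDr -vE mulfV //.
(* The leading term of [p] is multiplied by that combination, which moves it to the degrees below
   [d]. *)
pose p' := \poly_(i < d) (p`_i + p`_d * c (d - i)%N).
apply: (IHn x p' q) => //.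
- rewrite ltnS in ltn; apply: leq_trans ltn.
  by rewrite ltn_add2r (leq_ltn_trans (size_poly _ _)) // sz_p.
- move=> i; rewrite coef_poly; case: ifP => _; last exact: subring0.
  by apply: subringD => //; apply: subringM.
rewrite horner_poly [LHS]vp horner_coef sz_p big_ord_recr /=.
rewrite -[in LHS](mulr1 (x ^+ d)) -c1 !mulr_sumr.
rewrite (reindex_inj rev_ord_inj) /= -big_split /=.
rewrite [RHS](reindex_inj rev_ord_inj) /=; apply: eq_bigr => i _.
rewrite mulrDl; congr (_ + _); rewrite subKn // -mulrA; congr (_ * _).
rewrite mulrCA; congr (_ * _).
have xi_neq0 := expf_neq0 i.+1 x_neq0; apply: (mulIf xi_neq0).
by rewrite -mulrA exprVn mulVf // mulr1 -exprD subnK.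
Qed.

Lemma maximal_subring_valring : valring A.
Proof.
split=> // z; have [->|z_neq0] := eqVneq z 0; first by left; apply: subring0.
apply: contrapT => /not_orP[/maxA[p Ap vp] /maxA[q Aq vq]].
exact: maximal_subring_relation Ap Aq z_neq0 vp vq.
Qed.
End MaximalSubring.

(** Zorn's lemma gives a subring maximal among those that contain [B] but not [v^-1]; it is a
    valuation ring. *)
Lemma exists_valring B v : subring B -> B v -> ~ B v^-1 ->
  exists O, [/\ valring O, B `<=` O & ~ O v^-1].
Proof.
move=> subB Bv notBv.
pose good A := [/\ subring A, B `<=` A & ~ A v^-1].
have [|A [PA maxA]] := @Zorn_bigcup _ (fun A => A = set0 \/ good A).
  move=> C PC totC.
  have [[A0 CA0 goodA0]|noA] := pselect (exists2 A, C A & good A); last first.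
    left; rewrite -subset0 => z [A CA]; have [->//|goodA] := PC _ CA.
    by case: noA; exists A.
  have chain u w : (\bigcup_(X in C) X) u -> (\bigcup_(X in C) X) w ->
      exists A, [/\ C A, good A, A u & A w].
    move=> [A CA Au] [A' CA' Aw].
    have goodC X z : C X -> X z -> good X.
      by move=> CX Xz; have [X0|//] := PC _ CX; move: Xz; rewrite X0.
    have [AA'|A'A] := totC _ _ CA CA'.
      by exists A'; split=> //; [exact: goodC Aw|exact: AA'].
    by exists A; split=> //; [exact: goodC Au|exact: A'A].
  right; split.
  - split.
    + by exists A0 => //; case: goodA0 => /subring1.
    + move=> u w Cu Cw; have [A [CA [subA _ _] Au Aw]] := chain _ _ Cu Cw.
      by exists A => //; apply: subringB.
    + move=> u w Cu Cw; have [A [CA [subA _ _] Au Aw]] := chain _ _ Cu Cw.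
      by exists A => //; apply: subringM.
  - by move=> z Bz; exists A0 => //; case: goodA0 => _ + _; apply.
  - move=> Cv; have [A [_ [_ _ +] Av _]] := chain _ _ Cv Cv; exact.
have goodA : good A.
  case: PA => // A0; case: (maxA B); last by right; split.
  by rewrite A0; split=> // /(_ _ Bv).
case: (goodA) => subA BA notAv; exists A; split=> //.
apply: (maximal_subring_valring (v := v)) => // [|x notAx]; first exact: BA.
apply: contrapT => notAxv; apply: (maxA (adjoin A x)).
  by split=> [|/(_ x (mem_adjoin subA x))//]; apply: sub_adjoin.
right; split=> //; first exact: subring_adjoin.
by apply: subset_trans BA _; apply: sub_adjoin.
Qed.

End Subrings.

(** * Orders with respect to an element of a valuation ring *)

Section RingUnits.
Variables (F : fieldType) (O : set F).
Hypothesis subO : subring O.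

Definition vunit z := [/\ z != 0, O z & O z^-1].
Lemma vunit1 : vunit 1.
Proof. by rewrite /vunit oner_eq0 invr1; split=> //; apply: subring1. Qed.

Lemma vunitM z w : vunit z -> vunit w -> vunit (z * w).
Proof.
move=> [z0 Oz Oz1] [w0 Ow Ow1]; rewrite /vunit mulf_neq0 // invfM.
by split=> //; apply: subringM.
Qed.

Lemma vunitV z : vunit z -> vunit z^-1.
Proof. by move=> [z0 Oz Oz1]; rewrite /vunit invr_eq0 invrK. Qed.

Lemma vunitX z n : vunit z -> vunit (z ^+ n).
Proof.
move=> uz; elim: n => [|n IHn]; first by rewrite expr0; exact: vunit1.
by rewrite exprS; apply: vunitM.
Qed.

Lemma vunitXz z (n : int) : vunit z -> vunit (z ^ n).
Proof.
by move=> uz; case: n => n; rewrite ?NegzE -?exprnP -?exprnN; [|apply: vunitV]; apply: vunitX.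
Qed.

Lemma vunit_prod (I : Type) (r : seq I) (P : pred I) (f : I -> F) :
  (forall i, P i -> vunit (f i)) -> vunit (\prod_(i <- r | P i) f i).
Proof. by move=> Af; elim/big_ind: _ => //; [exact: vunit1|exact: vunitM]. Qed.

Lemma subring_pole W u p d : u != 0 -> O u^-1 -> O p -> ~ O p^-1 -> (0 < d)%N ->
  W * p ^+ d = u -> O W^-1 /\ ~ O W.
Proof.
move=> u_neq0 Ou1 Op notOp d_gt0 Wpd.
have p_neq0 : p != 0.
  by apply/eqP=> p0; apply: notOp; rewrite p0 invr0; apply: subring0.
have WE : W = u / p ^+ d by rewrite -Wpd mulfK // expf_neq0.
split=> [|OW].
  by rewrite WE invfM invrK mulrC; apply: subringM => //; apply: subringX.
apply: notOp; have -> : p^-1 = p ^+ d.-1 * (u^-1 * W).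
  case: d d_gt0 WE {Wpd} => // d _ ->.
  rewrite mulKf //= exprS invfM mulrCA mulfV ?mulr1 //.
  exact: expf_neq0.
by apply: subringM => //; [apply: subringX|apply: subringM].
Qed.

End RingUnits.

Section ValuationRings.
Variables (F : fieldType) (O : set F).
Hypothesis vO : valring O.

Let subO : subring O. Proof. by case: vO. Qed.

Lemma valring_total z : O z \/ O z^-1. Proof. by case: vO. Qed.

Lemma valring_root n z : (0 < n)%N -> O (z ^+ n) -> O z.
Proof.
case: n => // n _ Ozn; have [//|Oz1] := valring_total z.
have [->|z_neq0] := eqVneq z 0; first exact: subring0.
have -> : z = z ^+ n.+1 * z^-1 ^+ n.
  by rewrite exprS exprVn mulfK // expf_neq0.
by apply: subringM => //; apply: subringX.
Qed.

(** The maximal ideal of the valuation ring; zero is listed apart because [0^-1 = 0] lies in [O]. *)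
Definition nonunit z := z = 0 \/ ~ O z^-1.

Lemma nonunit_mem z : nonunit z -> O z.
Proof.
by move=> [->|nz]; [apply: subring0|have [] := valring_total z].
Qed.

Lemma nonunitM z u : nonunit z -> O u -> nonunit (z * u).
Proof.
move=> [->|nz] Ou; first by left; rewrite mul0r.
have [->|u_neq0] := eqVneq u 0; first by left; rewrite mulr0.
right=> Ozu; apply: nz; have -> : z^-1 = u * (z * u)^-1.
  by rewrite invfM mulrCA divff // mulr1.
exact: subringM.
Qed.

(** One of [z / (1 + z)] and its inverse lies in [O]. The first yields [(1 + z)^-1], the second
    would yield [z^-1]. *)
Lemma nonunit_vunit1D z : nonunit z -> vunit O (1 + z).
Proof.
move=> nz; have Oz := nonunit_mem nz; have O1 := subring1 subO.
case: nz => [->|nz]; first by rewrite addr0; apply: vunit1.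
have z_neq0 : z != 0 by apply/eqP=> z0; apply: nz; rewrite z0 invr0 -z0.
have [w0|w_neq0] := eqVneq (1 + z) 0.
  case: nz; have -> : z = - 1 by apply/eqP; rewrite -addr_eq0 addrC w0.
  by rewrite invrN invr1; apply: subringN.
split=> //; first exact: subringD.
have [Ozw|] := valring_total (z / (1 + z)).
  have -> : (1 + z)^-1 = 1 - z / (1 + z) by field.
  exact: subringB.
rewrite invfM invrK => Ozw; case: nz.
have -> : z^-1 = z^-1 * (1 + z) - 1 by field.
exact: subringB.
Qed.

Lemma nonunitD z w : nonunit z -> nonunit w -> nonunit (z + w).
Proof.
wlog Ozw : z w / O (z / w).
  move=> H nz nw; have [|] := valring_total (z / w); first by move=> *; apply: H.
  by rewrite invf_div addrC => *; apply: H.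
move=> nz nw; have [->|w_neq0] := eqVneq w 0; first by rewrite addr0.
have -> : z + w = w * (1 + z / w) by field.
by apply: nonunitM => //; apply: subringD => //; apply: subring1.
Qed.

Lemma nonunit_sum (I : Type) (r : seq I) (P : pred I) (f : I -> F) :
  (forall i, P i -> nonunit (f i)) -> nonunit (\sum_(i <- r | P i) f i).
Proof. by move=> Af; elim/big_ind: _ => [|u w|i] *; [by left|exact: nonunitD|exact: Af]. Qed.

Section Order.
Variable y : F.
Hypotheses (y_neq0 : y != 0) (y_nonunit : ~ O y^-1).

(** A relation, since [y] is only a nonzero nonunit here: an element need not have an order, but an
    order is unique. *)
Definition has_order (z : F) (e : int) := exists2 u, vunit O u & z = y ^ e * u.

Let nonunit_y : nonunit y. Proof. by right. Qed.
Let Oy : O y := nonunit_mem nonunit_y.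

Lemma has_order_neq0 z e : has_order z e -> z != 0.
Proof. by move=> [u [u0 _ _] ->]; rewrite mulf_neq0 // expfz_neq0. Qed.

Lemma has_order_vunit u : vunit O u -> has_order u 0.
Proof. by exists u => //; rewrite expr0z mul1r. Qed.

Lemma has_orderM z w e d : has_order z e -> has_order w d -> has_order (z * w) (e + d).
Proof.
move=> [u uu ->] [u' uu' ->]; exists (u * u'); first exact: vunitM.
by rewrite expfzDr // mulrACA.
Qed.

Lemma has_orderV z e : has_order z e -> has_order z^-1 (- e).
Proof. by move=> [u uu ->]; exists u^-1; [exact: vunitV|rewrite invfM invr_expz]. Qed.

Lemma has_orderXz z e n : has_order z e -> has_order (z ^ n) (e * n).
Proof.
move=> [u uu ->]; exists (u ^ n); first exact: vunitXz.
by by rewrite expfzMl exprz_exp.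
Qed.

Lemma has_order_y : has_order y 1.
Proof. by exists 1; [exact: vunit1|rewrite expr1z mulr1]. Qed.

Lemma has_order_mem z e : has_order z e -> O z <-> 0 <= e.
Proof.
move=> [u [u0 Ou Ou1] ->]; split=> [|e_ge0]; last first.
  apply: subringM => //; case: e e_ge0 => // e _.
  by rewrite -exprnP; apply: subringX.
case: e => // e Oz; case: y_nonunit.
have -> : y^-1 = (y ^ (Negz e) * u) * u^-1 * y ^+ e.
  by rewrite mulfK // NegzE -exprnN exprS invfM mulfVK // expf_neq0.
by do 2?apply: subringM => //; apply: subringX.
Qed.

Lemma has_order_nonunit z e : has_order z e -> 0 < e -> nonunit z.
Proof.
move=> ze e_gt0; right=> /(has_order_mem (has_orderV ze)).
by rewrite oppr_ge0 leNgt e_gt0.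
Qed.

Lemma has_order_unique z e d : has_order z e -> has_order z d -> e = d.
Proof.
move=> ze zd; have z0 := has_order_neq0 ze.
have H e1 d1 : has_order z e1 -> has_order z d1 -> 0 <= e1 - d1.
  move=> h1 h2; have := has_orderM h1 (has_orderV h2).
  rewrite divff // => /has_order_mem <-; exact: subring1.
by apply/eqP; rewrite eq_le -[e <= d]subr_ge0 -[d <= e]subr_ge0 !H.
Qed.

(** Divided by the term at [i0], the other terms are nonunits, so the sum is that term times one
    plus a nonunit, which is a unit. *)
Lemma has_order_sum (I : finType) (i0 : I) (c : I -> F) e :
  has_order (c i0) e ->
  (forall i, i != i0 -> c i = 0 \/ exists2 d, e < d & has_order (c i) d) ->
  has_order (\sum_i c i) e.
Proof.
move=> c0 c_gt; have c0_neq0 := has_order_neq0 c0.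
have ccV i : c i = c i0 * (c i / c i0) by rewrite mulrC divfK.
have -> : \sum_i c i = c i0 * (1 + \sum_(i | i != i0) c i / c i0).
  rewrite mulrDr mulr1 (bigD1 i0) //=; congr (_ + _).
  by rewrite mulr_sumr; apply: eq_bigr => i _; exact: ccV.
rewrite -[e]addr0; apply: has_orderM => //; apply: has_order_vunit.
apply: nonunit_vunit1D; apply: nonunit_sum => i /c_gt[->|[d lt_ed ci]].
  by left; rewrite mul0r.
apply: (has_order_nonunit (has_orderM ci (has_orderV c0))).
by rewrite subr_gt0.
Qed.

End Order.
End ValuationRings.

(** * Rational functions *)

Section Fractions.
Import FracField generic_quotient.
Local Open Scope quotient_scope.

Lemma fractionP (R : idomainType) (a : {fraction R}) :
  exists p q : R, q != 0 /\ a = tofrac p / tofrac q.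
Proof.
suff [p [q [q_neq0 eq_aq]]] : exists p q : R, q != 0 /\ a * tofrac q = tofrac p.
  by exists p, q; rewrite -eq_aq mulfK ?tofrac_eq0.
elim/quotW: a => r; exists (frac r).1, (frac r).2; split; first exact: denom_ratioP.
change (mul (\pi r) (tofrac (frac r).2) = tofrac (frac r).1).
rewrite !piE /mulf; apply/eqmodP; rewrite /= equivfE.
by rewrite !numden_Ratio ?(oner_eq0, mulf_neq0, denom_ratioP) // !mulr1 mulrC.
Qed.
End Fractions.

(** * Factoring rational functions at the points [alpha s] *)

Section RootFactorization.
Variables (k : fieldType) (t : nat) (alpha : 'I_t -> k).
Implicit Types (p q N D : {poly k}) (v : 'I_t -> int).

Local Notation lin s := ('X - (alpha s)%:P).

Definition rootprod v : {fraction {poly k}} := \prod_s tofrac (lin s) ^ v s.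

Lemma lin_neq0 s : tofrac (lin s) != 0.
Proof. by rewrite tofrac_eq0 polyXsubC_eq0. Qed.

Lemma poly_root_factorization p : p != 0 ->
  exists (c : 'I_t -> nat) (q : {poly k}),
    (forall s, ~~ root q (alpha s)) /\ p = (\prod_s lin s ^+ c s) * q.
Proof.
have [n] := ubnP (size p); elim: n p => // n IHn p ltpn p_neq0.
have [/existsP[s ps0]|no_root] := boolP [exists s, root p (alpha s)]; last first.
  exists (fun=> 0%N), p; split=> [s|]; first by rewrite (existsPn no_root).
  by rewrite big1 ?mul1r // => s _; rewrite expr0.
have [p1 def_p] := factor_theorem _ _ ps0.
have p1_neq0 : p1 != 0.
  by apply: contraNneq p_neq0 => p10; rewrite def_p p10 mul0r.
have [|c [q [q_root def_p1]]] := IHn p1 _ p1_neq0.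
  by move: ltpn; rewrite def_p size_Mmonic ?monicXsubC // size_XsubC addn2 /= ltnS.
exists (fun s' => nat_of_bool (s' == s) + c s')%N, q; split=> //.
rewrite def_p def_p1 mulrC mulrA; congr (_ * q).
under [RHS]eq_bigr do rewrite exprD.
rewrite big_split /=; congr (_ * _).
rewrite (bigD1 s) //= eqxx expr1 big1 ?mulr1 //.
by move=> i /negPf->; rewrite expr0.
Qed.

Lemma rootprodM v w : rootprod v * rootprod w = rootprod (fun s => v s + w s).
Proof.
rewrite /rootprod -big_split /=; apply: eq_bigr => s _.
by rewrite expfzDr // lin_neq0.
Qed.

Lemma rootprodV v : (rootprod v)^-1 = rootprod (fun s => - v s).
Proof.
by rewrite /rootprod -prodfV; apply: eq_bigr => s _; rewrite invr_expz.
Qed.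

Lemma rootprodX v n : rootprod v ^+ n = rootprod (fun s => n%:Z * v s).
Proof.
rewrite /rootprod -prodrXl; apply: eq_bigr => s _.
by rewrite exprnP exprz_exp mulrC.
Qed.

Lemma rootprod_neq0 v : rootprod v != 0.
Proof. by apply/prodf_neq0 => s _; rewrite expfz_neq0 // lin_neq0. Qed.

(** [v s] is the order of [a] at [alpha s]; the remaining factor is in lowest terms, so every zero
    of [D] is a pole of [a]. *)
Definition root_factorization (a : {fraction {poly k}}) v N D :=
  [/\ coprimep N D, forall s, ~~ root N (alpha s), forall s, ~~ root D (alpha s) &
      a = rootprod v * (tofrac N / tofrac D)].

Lemma root_factorizationP a : a != 0 -> exists v N D, root_factorization a v N D.
Proof.
have [p [q [q_neq0 ->]]] := fractionP a => a_neq0.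
have p_neq0 : p != 0.
  by apply: contraNneq a_neq0 => ->; rewrite tofrac0 mul0r.
have [c [p' [p'_root def_p]]] := poly_root_factorization p_neq0.
have [d [q' [q'_root def_q]]] := poly_root_factorization q_neq0.
have p'_neq0 : p' != 0 by apply: contraNneq p_neq0 => p'0; rewrite def_p p'0 mulr0.
have q'_neq0 : q' != 0 by apply: contraNneq q_neq0 => q'0; rewrite def_q q'0 mulr0.
pose g := gcdp p' q'; have g_neq0 : g != 0 by rewrite gcdp_eq0 (negPf p'_neq0).
have def_p' := divpK (dvdp_gcdl p' q'); have def_q' := divpK (dvdp_gcdr p' q').
exists (fun s => (c s)%:Z - (d s)%:Z), (p' %/ g), (q' %/ g); split.
- by rewrite coprimep_div_gcd // p'_neq0.
- by move=> s; move: (p'_root s); rewrite -{1}def_p' rootM negb_or => /andP[].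
- by move=> s; move: (q'_root s); rewrite -{1}def_q' rootM negb_or => /andP[].
have prodE (b : 'I_t -> nat) :
    tofrac (\prod_s lin s ^+ b s) = rootprod (fun s => (b s)%:Z).
  by rewrite rmorph_prod; apply: eq_bigr => s _; rewrite rmorphXn -exprnP.
rewrite def_p def_q !rmorphM /= !prodE invfM mulrACA rootprodV rootprodM.
congr (_ * _).
have gE r : g %| r -> tofrac r = tofrac (r %/ g) * tofrac g.
  by move=> /divpK {1}<-; rewrite rmorphM.
rewrite (gE p') ?dvdp_gcdl // (gE q') ?dvdp_gcdr //.
have gF_neq0 : tofrac g != 0 by rewrite tofrac_eq0.
by rewrite invfM mulrACA (mulfV gF_neq0) mulr1.
Qed.

End RootFactorization.

(** * Places of the Kummer extension *)

Section Curve.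
Variables (k : fieldType) (t : nat) (alpha : 'I_t -> k).
Hypothesis alpha_inj : injective alpha.
Variables (m : nat) (L : fieldType) (e : {rmorphism {fraction {poly k}} -> L}) (y : L).
Hypothesis m_gt0 : (0 < m)%N.

Local Notation lin s := ('X - (alpha s)%:P).
Local Notation f := (\prod_s lin s).
Hypothesis ym : y ^+ m = e (tofrac f).

Let ep : {rmorphism {poly k} -> L} := e \o @tofrac {poly k}.

Let f_neq0 : f != 0 :> {poly k}.
Proof. by apply/prodf_neq0 => s _; rewrite polyXsubC_eq0. Qed.

Lemma generator_neq0 : y != 0.
Proof.
apply/eqP=> y0; move/eqP: ym; rewrite y0 expr0n eqn0Ngt m_gt0 /= eq_sym fmorph_eq0.
by rewrite tofrac_eq0 (negPf f_neq0).
Qed.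

Definition expansion (a : 'I_m -> {fraction {poly k}}) := \sum_(i < m) e (a i) * y ^+ i.

Definition orders (a : 'I_m -> {fraction {poly k}}) (v : 'I_m -> 'I_t -> int) :=
  forall i, a i != 0 -> exists N D, root_factorization alpha (a i) (v i) N D.

Lemma orders_exist a : exists v, orders a v.
Proof.
suff /choice[v v_a] : forall i, exists v : 'I_t -> int,
    a i != 0 -> exists N D, root_factorization alpha (a i) v N D by exists v.
move=> i; have [->|a_neq0] := eqVneq (a i) 0; first by exists (fun=> 0).
by have [v [N [D aE]]] := root_factorizationP alpha a_neq0; exists v => _; exists N, D.
Qed.

(* The terms of an expansion have pairwise distinct orders at a totally ramified
   place, so the order of the sum is the least of them, attained at [i0]. *)
Definition leading (a : 'I_m -> {fraction {poly k}}) (v : 'I_m -> 'I_t -> int) s i0 :=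
  a i0 != 0 /\ forall i, a i != 0 ->
    m%:Z * v i0 s + i0%:Z <= m%:Z * v i s + i%:Z.

Lemma leading_exists a v s : (exists i, a i != 0) -> exists i0, leading a v s i0.
Proof.
move=> [i a_neq0].
by case: (@arg_minP _ _ _ i (fun i => a i != 0) (fun i => m%:Z * v i s + i%:Z) a_neq0)
  => i0 a0 a_min; exists i0.
Qed.

Lemma modz_order (i : 'I_m) (c : int) : ((m%:Z * c + i%:Z) %% m)%Z = i%:Z.
Proof.
by rewrite mulrC modzMDl modz_small //= ltz_nat ltn_ord.
Qed.

Lemma order_ge0 (j : nat) (c : int) : (j < m)%N -> 0 <= m%:Z * c + j%:Z -> 0 <= c.
Proof. by move=> ltjm; nia. Qed.

Section Local.
Variables (O : set L) (s0 : 'I_t).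
Hypotheses (vO : valring O) (constO : forall c, O (e (tofrac c%:P))).
Hypothesis linO : nonunit O (e (tofrac (lin s0))).

Let subO : subring O. Proof. by case: vO. Qed.

Lemma valring_poly p : O (ep p).
Proof.
elim/poly_ind: p => [|p c IHp]; first by rewrite rmorph0; apply: subring0.
rewrite rmorphD rmorphM; apply: subringD; [by []| |exact: constO].
apply: subringM => //; rewrite -[X in ep X](subrK (alpha s0)%:P) rmorphD.
apply: subringD; [by []| |exact: constO].
exact: nonunit_mem linO.
Qed.

Lemma const_vunit c : c != 0 -> vunit O (ep c%:P).
Proof.
move=> c_neq0; split; last 1 first.
- suff -> : (ep c%:P)^-1 = ep c^-1%:P by exact: constO.
  have epc_neq0 : ep c%:P != 0 by rewrite fmorph_eq0 tofrac_eq0 polyC_eq0.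
  apply: (mulfI epc_neq0).
  by rewrite (mulfV epc_neq0) -rmorphM -polyCM mulfV // polyC1 rmorph1.
- by rewrite fmorph_eq0 tofrac_eq0 polyC_eq0.
- exact: constO.
Qed.

(** Subtracting the value at [alpha s0] leaves a multiple of the nonunit [x - alpha s0], so [p] is a
    nonzero constant plus a nonunit. *)
Lemma nonroot_vunit p : ~~ root p (alpha s0) -> vunit O (ep p).
Proof.
rewrite rootE => c_neq0; set c := p.[_] in c_neq0.
have uc := const_vunit c_neq0; have [c0 _ Oc1] := uc.
have [q def_p] : exists q, p - c%:P = q * lin s0.
  by apply: factor_theorem; rewrite rootE !hornerE subrr.
have -> : ep p = ep c%:P * (1 + ep (lin s0) * (ep q * (ep c%:P)^-1)).
  rewrite -[p in LHS](subrK c%:P) def_p rmorphD rmorphM /= mulrDr mulr1 addrC.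
  by congr (_ + _); rewrite mulrCA [_ * (_ * _^-1)]mulrCA mulfV // mulr1 mulrC.
apply: vunitM => //; apply: nonunit_vunit1D => //; apply: nonunitM => //.
by apply: subringM => //; apply: valring_poly.
Qed.

Lemma nonroot_lin s : s != s0 -> ~~ root (lin s) (alpha s0).
Proof. by rewrite root_XsubC (inj_eq alpha_inj) eq_sym. Qed.

Let cofactor_vunit : vunit O (ep (\prod_(s | s != s0) lin s)).
Proof.
rewrite rmorph_prod; apply: vunit_prod => // s ns.
by apply: nonroot_vunit; apply: nonroot_lin.
Qed.

Let ymE : y ^+ m = ep (lin s0) * ep (\prod_(s | s != s0) lin s).
Proof. by rewrite ym (bigD1 s0) //= !rmorphM. Qed.

Lemma generator_nonunit : ~ O y^-1.
Proof.
move=> Oy1; case: (linO) => [/eqP|].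
  by rewrite fmorph_eq0 tofrac_eq0 polyXsubC_eq0.
apply; have [c0 Oc _] := cofactor_vunit.
have -> : (e (tofrac (lin s0)))^-1 =
    y^-1 ^+ m * ep (\prod_(s | s != s0) lin s).
  by rewrite exprVn ymE invfM mulfVK.
by apply: subringM => //; apply: subringX.
Qed.

Local Notation has_order := (has_order O y).

(** This is total ramification: [y ^+ m] is [x - alpha s0] times linear factors that are units of
    [O]. *)
Lemma has_order_lin s : has_order (ep (lin s)) (m%:Z * (s == s0)%:Z).
Proof.
have [->|ns] := eqVneq s s0; last first.
  by rewrite mulr0; apply: has_order_vunit; apply: nonroot_vunit; apply: nonroot_lin.
exists (ep (\prod_(s | s != s0) lin s))^-1; first exact: vunitV.
rewrite mulr1 -exprnP ymE mulfK //; by case: cofactor_vunit.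
Qed.

Lemma has_order_rootprod v : has_order (e (rootprod alpha v)) (m%:Z * v s0).
Proof.
have -> : m%:Z * v s0 = \sum_s m%:Z * (s == s0)%:Z * v s.
  rewrite (bigD1 s0) //= eqxx mulr1 big1 ?addr0 // => s /negPf->.
  by rewrite mulr0 mul0r.
have -> : e (rootprod alpha v) = \prod_s ep (lin s) ^ v s.
  by rewrite rmorph_prod; apply: eq_bigr => s _; rewrite rmorphXz ?unitfE ?lin_neq0.
elim/big_ind2: _ => [|z c w d|s _].
- by apply: has_order_vunit; apply: vunit1.
- by apply: has_orderM; rewrite // generator_neq0.
- by apply: has_orderXz; [|exact: has_order_lin].
Qed.

Lemma has_order_factorization a v N D : root_factorization alpha a v N D ->
  has_order (e a) (m%:Z * v s0).
Proof.
move=> [_ N_root D_root ->]; rewrite rmorphM -[m%:Z * _]addr0.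
apply: has_orderM; rewrite ?generator_neq0 //; first exact: has_order_rootprod.
apply: has_order_vunit; rewrite rmorphM fmorphV.
apply: vunitM => //; last apply: vunitV; exact: nonroot_vunit.
Qed.

Lemma has_order_leading a v i0 : orders a v -> leading a v s0 i0 ->
  has_order (expansion a) (m%:Z * v i0 s0 + i0%:Z).
Proof.
move=> va [a0 a_min].
have termE i : a i != 0 -> has_order (e (a i) * y ^+ i) (m%:Z * v i s0 + i%:Z).
  move=> /va[N [D aE]]; apply: has_orderM; rewrite ?generator_neq0 //.
    exact: has_order_factorization aE.
  exists 1; first exact: vunit1.
  by rewrite mulr1 -exprnP.
apply: (has_order_sum vO generator_neq0 generator_nonunit (termE _ a0)) => i ni.
have [->|ai] := eqVneq (a i) 0; first by left; rewrite rmorph0 mul0r.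
right; exists (m%:Z * v i s0 + i%:Z); last exact: termE.
(* Equal orders agree modulo [m], which recovers the exponent of [y]; the minimum is thus attained
   only at [i0]. *)
rewrite lt_neqAle a_min // andbT; apply: contraNneq ni => eq_v.
by apply/eqP/val_inj/eqP; rewrite -eqz_nat -(modz_order i (v i s0)) -eq_v modz_order.
Qed.

(** This is the linear independence over [k(x)] of the powers of [y] below [m]: an expansion with a
    nonzero component has an order, so it is not zero. *)
Lemma expansion_eq0 a : expansion a = 0 -> forall i, a i = 0.
Proof.
move=> a0 i; apply/eqP/negPn/negP => ai.
have [v va] := orders_exist a.
have [|i0 lead] := @leading_exists a v s0; first by exists i.
by have := has_order_neq0 generator_neq0 (has_order_leading va lead); rewrite a0 eqxx.
Qed.

End Local.

(** Reduction modulo [X^m - f]. The target field is left open because the identity serves both [y]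
    in [L] and its conjugates in an extension of [L]. *)
Lemma horner_modXnsubC (E : fieldType) (g : {rmorphism {fraction {poly k}} -> E}) (w : E)
    (p : {poly {fraction {poly k}}}) : w ^+ m = g (tofrac f) ->
  (map_poly g p).[w] = \sum_(i < m) g (p %% ('X^m - (tofrac f)%:P))`_i * w ^+ i.
Proof.
move=> wm; rewrite {1}(divp_eq p ('X^m - (tofrac f)%:P)).
rewrite rmorphD rmorphM rmorphB /= map_polyXn map_polyC /= !hornerE wm subrr mulr0 add0r.
rewrite (@horner_coef_wide _ m); first by apply: eq_bigr => i _; rewrite coef_map.
rewrite size_map_poly -ltnS -(size_XnsubC (tofrac f) m_gt0) ltn_modp.
by rewrite -size_poly_gt0 size_XnsubC.
Qed.

Hypothesis y_gen : forall z, exists p, z = (map_poly e p).[y].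

Lemma expansionP z : exists a, z = expansion a.
Proof.
have [p ->] := y_gen z; rewrite horner_modXnsubC //.
by exists (fun i : 'I_m => (p %% ('X^m - (tofrac f)%:P))`_i).
Qed.

Section Places.
Variable iota : {rmorphism k -> L}.
Hypothesis iotaE : forall c, iota c = e (tofrac c%:P).
Implicit Types (P : place iota) (z : L).

Definition centered P s := max_ideal P (e (tofrac (lin s))).

Lemma place_valring P : valring (val_ring P).
Proof. by case: P => O *; split. Qed.

Lemma place_const P c : val_ring P (e (tofrac c%:P)).
Proof.
by case: P => O ? ? ? [/= Oc _] *; apply: Oc; exists c.
Qed.

Lemma centered_nonunit P s : centered P s -> nonunit (val_ring P) (e (tofrac (lin s))).
Proof.
move=> [Olin nlin]; right=> Olin1; apply: nlin; split=> //.
by rewrite fmorph_eq0 tofrac_eq0 polyXsubC_eq0.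
Qed.

Section AtRoot.
Variables (P : place iota) (s : 'I_t).
Hypothesis Ps : centered P s.

Let vP := place_valring P.
Let subP : subring (val_ring P). Proof. by case: vP. Qed.
Let cP := place_const P.
Let nP := centered_nonunit Ps.
Let y0 := generator_neq0.
Let yP : ~ val_ring P y^-1 := generator_nonunit vP cP nP.

Lemma place_has_order_leading a v i0 : orders a v -> leading a v s i0 ->
  has_order (val_ring P) y (expansion a) (m%:Z * v i0 s + i0%:Z).
Proof. exact: (has_order_leading vP cP nP). Qed.

Lemma place_expansion_eq0 a : expansion a = 0 -> forall i, a i = 0.
Proof. exact: (expansion_eq0 vP cP nP). Qed.

Lemma expansion_neq0 a : expansion a != 0 -> exists i, a i != 0.
Proof.
move=> a_neq0; apply: contrapT => no_i; case/negP: a_neq0; apply/eqP.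
apply: big1 => i _; suff -> : a i = 0 by rewrite rmorph0 mul0r.
by apply/eqP/negPn/negP => ai; apply: no_i; exists i.
Qed.

(** A nonzero element of the maximal ideal has an order, read off its expansion; it is nonnegative
    and not 0, hence at least 1, so [y] divides the element. *)
Lemma prime_generator : prime_element P y.
Proof.
apply/seteqP; split=> z.
  move=> [Oz uz]; have [->|z_neq0] := eqVneq z 0.
    by exists 0; [apply: subring0; case: vP|rewrite mulr0].
  exists (y^-1 * z); last by rewrite mulVKf.
  have [a def_z] := expansionP z; rewrite def_z in z_neq0 Oz uz *.
  have [v va] := orders_exist a.
  have [i0 lead] := leading_exists v s (expansion_neq0 z_neq0).
  have zd := place_has_order_leading va lead; move: zd; set d := _ + _ => zd.
  have y1 := has_orderM vP y0 (has_orderV (has_order_y vP y)) zd.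
  apply/(has_order_mem vP y0 yP y1); rewrite addrC subr_ge0.
  have: 0 <= d by apply/(has_order_mem vP y0 yP zd).
  rewrite le_eqVlt => /orP[/eqP d0|//]; case: uz.
  by case: zd => u uu ->; rewrite -d0 expr0z mul1r.
move=> [u Ou <-]; have nyu : nonunit (val_ring P) (y * u) by apply: nonunitM => //; right.
split; first exact: nonunit_mem nyu.
by move=> [yu0 _ yu1]; case: nyu => [/eqP|//]; apply/negP.
Qed.

(** [nu] may pick any prime element, but two prime elements differ by a unit [c], whose power is
    absorbed in the unit factor. *)
Lemma nuE z d : has_order (val_ring P) y z d -> nu P z = d.
Proof.
move=> zd; apply: xget_unique.
  by case: (zd) => u uu ->; exists y, u; split=> //; exact: prime_generator.
move=> d' [y' [u [y'P uu zE]]].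
suff [c uc y'E] : exists2 c, vunit (val_ring P) c & y' = y * c.
  apply: (has_order_unique vP y0 yP _ zd).
  exists (c ^ d' * u); first by apply: vunitM => //; apply: vunitXz.
  by rewrite zE y'E expfzMl mulrA.
have O1 : val_ring P 1 by case: vP => /subring1.
have maxy : max_ideal P y by rewrite prime_generator; exists 1; rewrite ?mulr1.
have maxy' : max_ideal P y' by rewrite y'P; exists 1; rewrite ?mulr1.
move: maxy; rewrite y'P => -[b Ob y'b]; move: maxy'; rewrite prime_generator => -[c Oc yc].
have cb : c * b = 1 by apply: (mulfI y0); rewrite mulrA yc y'b mulr1.
have c_neq0 : c != 0 by apply: contra_eq_neq cb => ->; rewrite mul0r eq_sym oner_eq0.
exists c => //; split=> //.
by suff -> : c^-1 = b by []; apply: (mulfI c_neq0); rewrite mulfV.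
Qed.

Lemma nu_leading a v i0 : orders a v -> leading a v s i0 ->
  nu P (expansion a) = m%:Z * v i0 s + i0%:Z.
Proof. by move=> va lead; apply: nuE; apply: place_has_order_leading. Qed.

End AtRoot.

Lemma place_eq P P' : val_ring P = val_ring P' -> P = P'.
Proof.
case: P P' => O p1 p2 p3 p4 p5 p6 [O' q1 q2 q3 q4 q5 q6] /= eqO; subst O'.
by f_equal; apply: Prop_irrelevance.
Qed.

(** Whether an expansion lies in the valuation ring depends only on the sign of its leading order,
    which its components and [s] determine. *)
Lemma centered_unique P P' s : centered P s -> centered P' s -> P = P'.
Proof.
move=> Ps P's; apply: place_eq; apply/seteqP.
suff H P1 P2 : centered P1 s -> centered P2 s -> val_ring P1 `<=` val_ring P2.
  by split; apply: H.
move=> P1s P2s z; have [->|z_neq0] := eqVneq z 0.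
  by move=> _; apply: subring0; case: (place_valring P2).
have [a def_z] := expansionP z; rewrite def_z in z_neq0 *.
have [v va] := orders_exist a.
have [i0 lead] := leading_exists v s (expansion_neq0 z_neq0).
have mem P0 (P0s : centered P0 s) := has_order_mem (place_valring P0) generator_neq0
  (generator_nonunit (place_valring P0) (@place_const P0) (centered_nonunit P0s))
  (place_has_order_leading P0s va lead).
by rewrite (mem P1) // (mem P2).
Qed.

(** * Components of a regular function *)

Section Components.
Variables (n : nat) (Q : 'I_n -> place iota) (sg : 'I_n -> 'I_t) (l0 : 'I_n).
Hypothesis Qsg : forall l, centered (Q l) (sg l).
Variables (E : fieldType) (h : {rmorphism L -> E}) (w : E).
Hypotheses (w_prim : m.-primitive_root w) (m_neq0 : m%:R != 0 :> k).

Let g : {rmorphism {fraction {poly k}} -> E} := h \o e.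

(* Over a field containing the [m]-th roots of unity, [y |-> w ^+ j * y] defines
   conjugates of [z], and the component [a i * y ^+ i] is a weighted average of
   them.  Pulling a valuation ring of [E] back along each conjugation gives a
   place of [L], at which [z] is regular. *)
Section Pullback.
Variable O : set E.
Hypotheses (vO : valring O) (constO : forall c, O (g (tofrac c%:P))).
Hypothesis polesO : forall l, O (g (tofrac (lin (sg l)))^-1).
Hypothesis properO : exists a, ~ O (g a).

Let subO : subring O. Proof. by case: vO. Qed.

Section Conjugate.
Variable x : E.
Hypothesis xm : x ^+ m = g (tofrac f).

(** The difference of the polynomials vanishes at [y], so by linear independence its remainder
    modulo [X^m - f] is zero, and it vanishes at [x] too. *)
Lemma conjugate_well_defined p q : (map_poly e p).[y] = (map_poly e q).[y] ->
  (map_poly g p).[x] = (map_poly g q).[x].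
Proof.
move=> eq_pq; have : (map_poly e (p - q)).[y] = 0.
  by rewrite rmorphB !hornerE eq_pq subrr.
rewrite horner_modXnsubC // => r0; apply/eqP; rewrite -subr_eq0.
have -> : (map_poly g p).[x] - (map_poly g q).[x] = (map_poly g (p - q)).[x].
  by rewrite rmorphB !hornerE.
rewrite horner_modXnsubC // big1 // => i _.
have := place_expansion_eq0 (Qsg l0) (a := fun i : 'I_m => _) r0 i => ->.
by rewrite rmorph0 mul0r.
Qed.

(** The preimage of [O] under the embedding of [L] into [E] that sends [y] to [x], described by
    polynomial representatives. *)
Definition pullback : set L :=
  [set z | exists2 p, z = (map_poly e p).[y] & O (map_poly g p).[x]].

Lemma pullbackE p : pullback (map_poly e p).[y] <-> O (map_poly g p).[x].
Proof.
by split=> [[q /conjugate_well_defined -> //]|Op]; exists p.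
Qed.

Lemma pullback_frac a : pullback (e a) <-> O (g a).
Proof. by have := pullbackE a%:P; rewrite !map_polyC /= !hornerC. Qed.

Lemma pullback_total z : pullback z \/ pullback z^-1.
Proof.
have [p def_z] := y_gen z; have [q def_z1] := y_gen z^-1.
have [z0|z_neq0] := eqVneq z 0.
  left; rewrite z0 -(rmorph0 e); apply/pullback_frac.
  by rewrite rmorph0; apply: subring0.
rewrite {1}def_z def_z1.
have pq1 : (map_poly g p).[x] * (map_poly g q).[x] = 1.
  rewrite -hornerM -rmorphM (conjugate_well_defined (q := 1)).
    by rewrite rmorph1 hornerC.
  by rewrite rmorphM hornerM -def_z -def_z1 mulfV // rmorph1 hornerC.
have p_neq0 : (map_poly g p).[x] != 0.
  by apply: contra_eq_neq pq1 => ->; rewrite mul0r eq_sym oner_eq0.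
have qE : (map_poly g p).[x]^-1 = (map_poly g q).[x].
  by apply: (mulfI p_neq0); rewrite pq1 mulfV.
have [Op|] := valring_total vO (map_poly g p).[x].
  by left; apply/pullbackE.
by rewrite qE => Oq; right; apply/pullbackE.
Qed.

Lemma pullback_subring : subring pullback.
Proof.
split.
- by rewrite -(rmorph1 e); apply/pullback_frac; rewrite rmorph1; apply: subring1.
- move=> _ _ [p -> Op] [q -> Oq]; exists (p - q); first by rewrite rmorphB !hornerE.
  by rewrite rmorphB !hornerE; apply: subringB.
- move=> _ _ [p -> Op] [q -> Oq]; exists (p * q); first by rewrite rmorphM !hornerE.
  by rewrite rmorphM !hornerE; apply: subringM.
Qed.

Lemma pullback_const : range iota `<` pullback.
Proof.
split.
  by move=> _ [c _ <-]; rewrite iotaE; apply/pullback_frac.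
move=> sub_const.
have X_neq0 : tofrac 'X != 0 :> {fraction {poly k}} by rewrite tofrac_eq0 polyX_eq0.
have [OX|OX] := pullback_total (e (tofrac 'X)).
  have [c _] := sub_const _ OX; rewrite iotaE => /fmorph_inj/eqP.
  rewrite tofrac_eq => /eqP/(congr1 (size \o val)) /=.
  by rewrite size_polyX size_polyC; case: (_ != _).
have [c _] := sub_const _ OX; rewrite iotaE => eq_c.
have : e (tofrac (c%:P * 'X)) = 1.
  by rewrite tofracM rmorphM eq_c mulVf // fmorph_eq0.
rewrite -(rmorph1 e) => /fmorph_inj/eqP; rewrite -tofrac1 tofrac_eq => /eqP cX1.
by move/(congr1 (horner^~ 0)): cX1; rewrite !hornerE => /eqP; rewrite eq_sym oner_eq0.
Qed.

Lemma pullback_proper : pullback `<` setT.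
Proof.
have [a notOa] := properO; split=> // /(_ (e a) I) /pullback_frac.
exact: notOa.
Qed.

Definition pullback_place : place iota :=
  Place (subring1 pullback_subring) (subringB pullback_subring)
    (subringM pullback_subring) pullback_const pullback_proper pullback_total.

Lemma pullback_place_neq l : pullback_place <> Q l.
Proof.
move=> eqQ; have [l_neq0|] := centered_nonunit (Qsg l).
  by move/eqP: l_neq0; rewrite fmorph_eq0 tofrac_eq0 polyXsubC_eq0.
by apply; rewrite -eqQ -fmorphV; apply/pullback_frac/polesO.
Qed.

Lemma regular_conjugate a : regular_outside Q (expansion a) ->
  O (\sum_(i < m) g (a i) * x ^+ i).
Proof.
pose p := \sum_(i < m) a i *: 'X^i.
have hornerp (E' : fieldType) (g' : {rmorphism {fraction {poly k}} -> E'}) x' :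
    (map_poly g' p).[x'] = \sum_(i < m) g' (a i) * x' ^+ i.
  rewrite rmorph_sum horner_sum; apply: eq_bigr => i _.
  by rewrite /= map_polyZ map_polyXn !hornerE.
move=> za; have : pullback (expansion a) := za pullback_place pullback_place_neq.
by rewrite -(hornerp E g) /expansion -(hornerp L e) => /pullbackE.
Qed.

End Conjugate.

Lemma regular_component a i : regular_outside Q (expansion a) ->
  O (h (e (a i) * y ^+ i)).
Proof.
move=> za; pose c (i' : 'I_m) := g (a i') * h y ^+ i'.
have wm1 := prim_expr_order w_prim.
have Ow : O w by apply: (valring_root vO m_gt0); rewrite wm1; apply: subring1.
have Oconj (j : 'I_m) : O (\sum_(i' < m) c i' * (w ^+ j) ^+ i').
  under eq_bigr do rewrite -mulrA -exprMn.
  apply: regular_conjugate => //.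
  by rewrite exprMn exprAC wm1 expr1n mulr1 -rmorphXn ym.
(* The conjugate by [w ^+ j] gets the weight [w ^- (i * j)], written with exponent [m - i]; for
   [i' != i] the coefficient is a full geometric sum of an [m]-th root of unity other than 1, which
   vanishes. *)
have sumE : \sum_(j < m) (w ^+ j) ^+ (m - i) * (\sum_(i' < m) c i' * (w ^+ j) ^+ i')
    = m%:R * c i.
  under eq_bigr do rewrite mulr_sumr.
  rewrite exchange_big (bigD1 i) //= [X in _ + X]big1 ?addr0.
    under eq_bigr do rewrite mulrCA -exprD subnK ?(ltnW (ltn_ord _)) // exprAC wm1 expr1n mulr1.
    by rewrite sumr_const card_ord mulr_natl.
  move=> i' ni'; pose z := w ^+ (m - i + i').
  have zm1 : z ^+ m = 1 by rewrite exprAC wm1 expr1n.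
  have z_neq1 : z != 1.
    rewrite -(prim_order_dvd w_prim); apply/negP=> /dvdnP[q def_q].
    have lt_im := ltn_ord i; have lt_i'm := ltn_ord i'.
    have q1 : q = 1%N by case: q def_q => [|[|q]] //; nia.
    by case/eqP: ni'; apply/val_inj; rewrite /= q1 in def_q *; lia.
  under eq_bigr do rewrite mulrCA -exprD exprAC.
  rewrite -mulr_sumr; suff -> : \sum_(j < m) z ^+ j = 0 by rewrite mulr0.
  apply/eqP; rewrite -(mulrI_eq0 _ (mulfI (x := z - 1) _)) ?subr_eq0 //.
  by rewrite -subrX1 zm1 subrr.
pose gk : {rmorphism k -> E} := g \o (@tofrac {poly k} \o polyC).
have Om : O (m%:R)^-1 by rewrite -(rmorph_nat gk) -fmorphV; apply: constO.
have mE_neq0 : m%:R != 0 :> E by rewrite -(rmorph_nat gk) fmorph_eq0.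
have -> : h (e (a i) * y ^+ i) = m%:R^-1 * (m%:R * c i).
  by rewrite mulKf // rmorphM rmorphXn.
rewrite -sumE; apply: subringM => //; apply: subring_sum => // j _.
by apply: subringM => //; apply: subringX => //; apply: subringX.
Qed.

End Pullback.

Local Notation K := {fraction {poly k}}.

(** The instances used are the functions finite at infinity and the fractions whose denominators are
    prime to a polynomial with no zero among the [alpha (sg l)]. *)
Definition admissible (B : set K) := [/\ subring B, forall c, B (tofrac c%:P) &
  forall l, B (tofrac (lin (sg l)))^-1].

Definition pole_free (W : K) := forall B, admissible B -> B W^-1 -> B W.

(** Here [W] is [(a i * y ^+ i) ^+ m], a rational function. If [B] contained [W^-1] but not [W], a
    valuation ring of [E] above the image of [B] would avoid [W], whereas it contains the
    component. *)
Lemma regular_pole_free a i v N D : regular_outside Q (expansion a) ->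
  root_factorization alpha (a i) v N D ->
  pole_free (rootprod alpha (fun s => m%:Z * v s + i%:Z) * (tofrac N / tofrac D) ^+ m).
Proof.
move=> za [_ _ _ aiE]; set W := _ * _ => B [subB constB polesB] BW1.
have WE : W = a i ^+ m * tofrac f ^+ i.
  have -> : tofrac f = rootprod alpha (fun=> 1).
    by rewrite rmorph_prod; apply: eq_bigr => s _; rewrite expr1z.
  rewrite /W aiE [(rootprod _ _ * _) ^+ m]exprMn !rootprodX mulrAC rootprodM.
  congr (rootprod _ _ * _).
  by apply/funext => s; rewrite mulr1.
apply: contrapT => notBW.
have [] := @exists_valring E (g @` B) (g W^-1).
- split.
  + by exists 1; [exact: subring1|rewrite rmorph1].
  + move=> _ _ [u Bu <-] [u' Bu' <-].
    by exists (u - u'); [exact: subringB|rewrite rmorphB].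
  + move=> _ _ [u Bu <-] [u' Bu' <-].
    by exists (u * u'); [exact: subringM|rewrite rmorphM].
- by exists W^-1.
- by rewrite -fmorphV invrK => -[u Bu /fmorph_inj uW]; apply: notBW; rewrite -uW.
rewrite -fmorphV invrK => O [vO gBO notOW]; apply: (notOW).
have subO : subring O by case: vO.
suff -> : g W = h (e (a i) * y ^+ i) ^+ m.
  apply: subringX => //; apply: (regular_component vO _ _ _ i za).
  - by move=> c; apply: gBO; exists (tofrac c%:P).
  - by move=> l; apply: gBO; exists (tofrac (lin (sg l)))^-1.
  - by exists W.
by rewrite WE -rmorphXn exprMn -exprM mulnC exprM ym -!rmorphXn -rmorphM.
Qed.

Lemma pole_free_absurd W u p d (B : set K) : pole_free W -> admissible B ->
  u != 0 -> B u^-1 -> B p -> ~ B p^-1 -> (0 < d)%N -> W * p ^+ d = u -> False.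
Proof.
move=> Wp admB u_neq0 Bu1 Bp notBp d_gt0 Wpd; have [subB _ _] := admB.
have [BW1 notBW] := subring_pole subB u_neq0 Bu1 Bp notBp d_gt0 Wpd.
by apply: notBW; apply: Wp.
Qed.

Section Localization.
Variable d : {poly k}.
Hypothesis d_gt1 : (1 < size d)%N.

(** The semilocal ring at the zeros of [d], so that a whole denominator can serve as [d] and no
    irreducible factor has to be chosen. *)
Definition localization : set K :=
  [set a | exists A C, coprimep C d /\ a = tofrac A / tofrac C].

Lemma coprimep_neq0 C : coprimep C d -> tofrac C != 0.
Proof.
rewrite tofrac_eq0; apply: contraTneq => ->.
by rewrite coprime0p -size_poly_eq1 neq_ltn d_gt1 orbT.
Qed.

Lemma localization_poly A C : coprimep C d -> localization (tofrac A / tofrac C).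
Proof. by exists A, C. Qed.

Lemma localization_coprime C : coprimep C d -> vunit localization (tofrac C).
Proof.
move=> Cd; split; first exact: coprimep_neq0.
- by rewrite -[tofrac C]divr1 -tofrac1; apply: localization_poly; apply: coprime1p.
- by rewrite -[_^-1]mul1r -tofrac1; apply: localization_poly.
Qed.

Lemma localization_subring : subring localization.
Proof.
split.
- by exists 1, 1; rewrite coprime1p tofrac1 divr1.
- move=> _ _ [A [C [Cd ->]]] [A' [C' [C'd ->]]].
  exists (A * C' - A' * C), (C * C'); split; first by rewrite coprimepMl Cd.
  by rewrite -mulNr addf_div ?coprimep_neq0 // mulNr tofracB !tofracM.
- move=> _ _ [A [C [Cd ->]]] [A' [C' [C'd ->]]].
  exists (A * A'), (C * C'); split; first by rewrite coprimepMl Cd.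
  by rewrite mulf_div !tofracM.
Qed.

Lemma localization_admissible : (forall l, coprimep (lin (sg l)) d) ->
  admissible localization.
Proof.
move=> ld; split; first exact: localization_subring.
- move=> c; rewrite -[tofrac _]divr1 -tofrac1; apply: localization_poly.
  exact: coprime1p.
- by move=> l; case: (localization_coprime (ld l)).
Qed.

Lemma localization_self : localization (tofrac d).
Proof. by rewrite -[tofrac _]divr1 -tofrac1; apply: localization_poly; apply: coprime1p. Qed.

Lemma localization_inv : ~ localization (tofrac d)^-1.
Proof.
move=> [A [C [Cd dE]]].
have d_neq0 : tofrac d != 0 by rewrite tofrac_eq0 -size_poly_gt0 ltnW.
have /eqP : tofrac C = tofrac (A * d).
  rewrite tofracM -(divfK (coprimep_neq0 Cd) (tofrac A)) -dE.
  by rewrite mulrAC (mulVf d_neq0) mul1r.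
rewrite tofrac_eq => /eqP CE.
move: Cd; rewrite CE coprimepMl coprimepp => /andP[_ /eqP d1].
by move: d_gt1; rewrite d1.
Qed.

End Localization.

Definition finite_at_infinity : set K :=
  [set a | exists A C : {poly k}, [/\ C != 0, (size A <= size C)%N & a = tofrac A / tofrac C]].

Lemma finite_at_infinity_subring : subring finite_at_infinity.
Proof.
have size_le (A C A' C' : {poly k}) : C != 0 -> C' != 0 -> (size A <= size C)%N ->
    (size A' <= size C')%N -> (size (A * A')%R <= size (C * C')%R)%N.
  move=> C0 C'0 leAC leA'C'; apply: leq_trans (size_polyMleq A A') _.
  by rewrite size_mul // -!subn1 leq_sub2r // leq_add.
split.
- by exists 1, 1; rewrite oner_eq0 tofrac1 divr1.
- move=> _ _ [A [C [C0 leAC ->]]] [A' [C' [C'0 leA'C' ->]]].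
  exists (A * C' - A' * C), (C * C'); split; first exact: mulf_neq0.
    apply: leq_trans (size_polyD _ _) _; rewrite geq_max size_polyN size_le //.
    by rewrite [A' * C]mulrC size_le.
  by rewrite -mulNr addf_div ?tofrac_eq0 // mulNr tofracB !tofracM.
- move=> _ _ [A [C [C0 leAC ->]]] [A' [C' [C'0 leA'C' ->]]].
  exists (A * A'), (C * C'); split; [exact: mulf_neq0|exact: size_le|].
  by rewrite mulf_div !tofracM.
Qed.

Lemma finite_at_infinity_admissible : admissible finite_at_infinity.
Proof.
split; first exact: finite_at_infinity_subring.
- move=> c; exists c%:P, 1; rewrite oner_eq0 tofrac1 divr1 size_poly1.
  by rewrite size_polyC leq_b1.
- move=> l; exists 1, (lin (sg l)); rewrite polyXsubC_eq0 tofrac1 mul1r.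
  by rewrite size_poly1 size_XsubC.
Qed.

Lemma finite_at_infinity_unit (A C : {poly k}) : size A = size C -> C != 0 ->
  vunit finite_at_infinity (tofrac A / tofrac C).
Proof.
move=> szAC C0; have A0 : A != 0 by rewrite -size_poly_gt0 szAC size_poly_gt0.
split; first by rewrite mulf_neq0 ?invr_eq0 ?tofrac_eq0.
- by exists A, C; rewrite szAC.
- by exists C, A; rewrite szAC invf_div.
Qed.

Section Bounds.
Variables (v : 'I_t -> int) (N D : {poly k}) (a : K) (j : nat).
Hypothesis aE : root_factorization alpha a v N D.
Hypothesis a_neq0 : a != 0.
Let mv s := m%:Z * v s + j%:Z.
Let W := rootprod alpha mv * (tofrac N / tofrac D) ^+ m.
Hypothesis Wfree : pole_free W.

Let coprimep_lin p s : ~~ root p (alpha s) -> coprimep (lin s) p.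
Proof. by rewrite coprimep_sym coprimep_XsubC. Qed.

Let N_neq0 : N != 0.
Proof. by case: aE => _ _ _; apply: contra_eq_neq => ->; rewrite tofrac0 mul0r mulr0. Qed.
Let D_neq0 : D != 0.
Proof. by case: aE => _ _ _; apply: contra_eq_neq => ->; rewrite tofrac0 invr0 !mulr0. Qed.

(** In the localization at a nonconstant [D], [W] would be a unit divided by [D ^+ m], and [D] is
    not invertible there. *)
Lemma pole_free_denominator : size D = 1%N.
Proof.
case: aE => copND _ D_root _; apply/eqP; rewrite eqn_leq size_poly_gt0 D_neq0 andbT.
rewrite leqNgt; apply/negP => D_gt1.
have subB := localization_subring D_gt1.
have [u_neq0 _ Bu1] : vunit (localization D) (rootprod alpha mv * tofrac N ^+ m).
  apply: (vunitM subB); last exact: (vunitX subB _ (localization_coprime D_gt1 copND)).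
  apply: (vunit_prod subB) => s _; apply: (vunitXz subB).
  exact: (localization_coprime D_gt1 (coprimep_lin (D_root s))).
apply: (pole_free_absurd Wfree
  (localization_admissible D_gt1 (fun l => coprimep_lin (D_root (sg l))))
  u_neq0 Bu1 (localization_self D) (localization_inv D_gt1) m_gt0).
have clear_denominator (F : fieldType) (r a' b' : F) : b' != 0 ->
    r * (a' / b') ^+ m * b' ^+ m = r * a' ^+ m.
  by move=> b'_neq0; rewrite -mulrA -exprMn divfK.
by apply: clear_denominator; rewrite tofrac_eq0.
Qed.

(** In the localization at [x - alpha s], which is admissible as [s] is none of the [sg l], a
    negative [mv s] makes [W] a unit divided by a power of [x - alpha s]. *)
Lemma pole_free_root s : (forall l, s != sg l) -> 0 <= mv s.
Proof.
move=> s_sg; rewrite leNgt; apply/negP => mv_lt0.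
have lin_gt1 : (1 < size (lin s))%N by rewrite size_XsubC.
have subB := localization_subring lin_gt1.
have cop_lin s' : s' != s -> coprimep (lin s') (lin s).
  by move=> ns; apply: coprimep_lin; rewrite root_XsubC (inj_eq alpha_inj).
have lF_neq0 := lin_neq0 alpha s.
case: aE => _ N_root D_root _.
pose u := \prod_(s' | s' != s) tofrac (lin s') ^ mv s' * (tofrac N / tofrac D) ^+ m.
have [u_neq0 _ Bu1] : vunit (localization (lin s)) u.
  have cop p : ~~ root p (alpha s) -> vunit (localization (lin s)) (tofrac p).
    by move=> ps; apply: (localization_coprime lin_gt1); rewrite coprimep_sym; apply: coprimep_lin.
  apply: (vunitM subB).
    apply: (vunit_prod subB) => s' ns; apply: (vunitXz subB).
    exact: (localization_coprime lin_gt1 (cop_lin _ ns)).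
  apply: (vunitX subB); apply: (vunitM subB); first exact: (cop _ (N_root s)).
  exact: (vunitV (cop _ (D_root s))).
apply: (pole_free_absurd (d := `|mv s|%N) Wfree (localization_admissible lin_gt1 _)
  u_neq0 Bu1 (localization_self _) (localization_inv lin_gt1)).
- by move=> l; apply: cop_lin; rewrite eq_sym.
- by rewrite absz_gt0 lt_eqF.
have cancel_pole (F : fieldType) (x r b : F) c : x != 0 -> c < 0 ->
    x ^ c * r * b * x ^+ `|c|%N = r * b.
  move=> x_neq0 c_lt0; rewrite mulrC exprnP ltz0_abs // !mulrA -expfzDr //.
  by rewrite addNr expr0z mul1r.
by rewrite /W /rootprod (bigD1 s) ?(cancel_pole _ _ _ _ _ lF_neq0 mv_lt0).
Qed.

(** Apart from [(N / D) ^+ m], which has no zero at infinity as [D] is constant, [W] grows there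
    like the power of [x] with exponent [\sum_s mv s]; a positive exponent would be a pole. *)
Lemma pole_free_sum : \sum_s mv s <= 0.
Proof.
rewrite leNgt; apply/negP => mv_gt0.
have subB := finite_at_infinity_subring.
have X_neq0 : tofrac 'X != 0 :> K by rewrite tofrac_eq0 polyX_eq0.
have D1 := pole_free_denominator.
pose u := \prod_s (tofrac (lin s) / tofrac 'X) ^ mv s * (tofrac N / tofrac D) ^+ m.
have lX_unit s : vunit finite_at_infinity (tofrac (lin s) / tofrac 'X).
  by apply: finite_at_infinity_unit; rewrite ?polyX_eq0 // size_XsubC size_polyX.
have [p_neq0 _ Bp1] : vunit finite_at_infinity (\prod_s (tofrac (lin s) / tofrac 'X) ^ mv s).
  by apply: (vunit_prod subB) => s _; apply: (vunitXz subB); apply: lX_unit.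
have NF_neq0 : tofrac N != 0 by rewrite tofrac_eq0.
have DF_neq0 : tofrac D != 0 by rewrite tofrac_eq0.
have u_neq0 : u != 0.
  exact: (mulf_neq0 p_neq0 (expf_neq0 m (mulf_neq0 NF_neq0 (invr_neq0 DF_neq0)))).
have invE (F : fieldType) (r b c : F) : (r * (b / c) ^+ m)^-1 = r^-1 * (c / b) ^+ m.
  by rewrite invfM -exprVn invf_div.
have Bu1 : finite_at_infinity u^-1.
  rewrite /u invE; apply: (subringM subB Bp1); apply: (subringX subB).
  by exists D, N; rewrite D1; split=> //; rewrite size_poly_gt0.
have BX : finite_at_infinity (tofrac 'X)^-1.
  exists 1, 'X; rewrite polyX_eq0 size_poly1 size_polyX tofrac1 mul1r.
  by split.
have notBX : ~ finite_at_infinity (tofrac 'X)^-1^-1.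
  rewrite invrK => -[A [C [C0 leAC XE]]].
  have CF_neq0 : tofrac C != 0 by rewrite tofrac_eq0.
  have /eqP : tofrac A = tofrac ('X * C) by rewrite tofracM XE (divfK CF_neq0).
  rewrite tofrac_eq => /eqP AE; move: leAC.
  by rewrite AE mulrC size_mulX // ltnn.
have d_gt0 : (0 < absz (\sum_s mv s)%R)%N by rewrite absz_gt0 gt_eqF.
apply: (pole_free_absurd Wfree finite_at_infinity_admissible u_neq0 Bu1 BX notBX d_gt0).
have cancel_pole (F : fieldType) (z : 'I_t -> F) (x b : F) : x != 0 ->
    \prod_s z s ^ mv s * b * x^-1 ^+ absz (\sum_s mv s) = \prod_s (z s / x) ^ mv s * b.
  move=> x_neq0; rewrite mulrAC; congr (_ * _); rewrite exprnP gtz0_abs //.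
  rewrite (big_morph _ (fun i j => expfzDr i j (invr_neq0 x_neq0)) (expr0z _)) -big_split /=.
  by apply: eq_bigr => s _; rewrite expfzMl.
exact: (cancel_pole _ (fun s => tofrac (lin s)) _ ((tofrac N / tofrac D) ^+ m) X_neq0).
Qed.

Hypothesis sg_inj : injective sg.

Lemma pole_free_bound : (j < m)%N -> m%:Z * (\sum_l v (sg l)) + (j * t)%N%:Z <= 0.
Proof.
move=> ltjm; apply: le_trans pole_free_sum.
have -> : \sum_s mv s = m%:Z * (\sum_s v s) + (j * t)%N%:Z.
  rewrite big_split /= -mulr_sumr sumr_const card_ord; congr (_ + _).
  by rewrite -mulr_natr natz PoszM.
rewrite lerD2r ler_pM2l ?ltz_nat //.
rewrite (bigID (mem [set sg l | l : 'I_n]%SET)) /= big_imset /=; last by move=> ? ? _ _ /sg_inj.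
rewrite lerDl; apply: sumr_ge0 => s s_sg.
(* With [j < m], [0 <= m * v s + j] already forces [0 <= v s], so the roots not among the [sg l]
   only increase the sum. *)
apply: (order_ge0 ltjm); apply: pole_free_root => l.
by apply: contraNneq s_sg => ->; apply: imset_f.
Qed.

End Bounds.
End Components.

(** * Regular monomials *)

Section Regular.
Variables (n : nat) (Q : 'I_n -> place iota) (sg : 'I_n -> 'I_t).
Hypothesis Qsg : forall l, centered (Q l) (sg l).

Lemma regular_outside_sum (I : Type) (r : seq I) (A : pred I) (z : I -> L) :
  (forall i, A i -> regular_outside Q (z i)) ->
  regular_outside Q (\sum_(i <- r | A i) z i).
Proof.
move=> zQ P PQ; apply: subring_sum => [|i Ai]; first by case: (place_valring P).
exact: zQ.
Qed.

(** Where ['X] is finite, the factors at the [alpha (sg l)] are units and the others have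
    nonnegative exponents. Where ['X] has a pole, the [m]-th power has order
    [- (m * \sum_s v s + i * t)] with respect to the inverse of ['X]. *)
Lemma regular_monomial (v : 'I_t -> int) i :
  (forall s, (forall l, s != sg l) -> 0 <= v s) ->
  m%:Z * (\sum_s v s) + (i * t)%N%:Z <= 0 ->
  regular_outside Q (e (rootprod alpha v) * y ^+ i).
Proof.
move=> v_ge0 v_sum P PQ; have vP := place_valring P.
have subP : subring (val_ring P) by case: vP.
have constP := place_const P.
have fE : e (tofrac f) = \prod_s ep (lin s) by rewrite -[LHS]/(ep f) rmorph_prod.
have rootprodE : e (rootprod alpha v) = \prod_s ep (lin s) ^ v s.
  by rewrite rmorph_prod; apply: eq_bigr => s _; rewrite rmorphXz ?unitfE ?lin_neq0.
have [OX|notOX] := pselect (val_ring P (ep 'X)).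
  have Olin s : val_ring P (ep (lin s)).
    by rewrite rmorphB; apply: subringB => //; apply: constP.
  have Oy : val_ring P y.
    by apply: (valring_root vP m_gt0); rewrite ym fE; apply: subring_prod.
  apply: subringM => //; last exact: subringX.
  rewrite rootprodE; apply: subring_prod => // s _.
  have [/existsP[l /eqP ->]|no_l] := boolP [exists l, s == sg l]; last first.
    have := v_ge0 s (existsPn no_l); case: (v s) => // d _.
    by rewrite -exprnP; apply: subringX.
  suff /(vunitXz subP (v (sg l)))[] : vunit (val_ring P) (ep (lin (sg l))) by [].
  apply: contrapT => not_unit; apply: (PQ l).
  apply: (centered_unique (s := sg l)); last exact: Qsg.
  by split; [exact: Olin|exact: not_unit].
have X_neq0 : ep 'X != 0.
  by apply/eqP=> X0; apply: notOX; rewrite X0; apply: subring0.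
pose x := (ep 'X)^-1; have x_neq0 : x != 0 by rewrite invr_eq0.
have x_nonunit : ~ val_ring P x^-1 by rewrite invrK.
have ord_lin s : has_order (val_ring P) x (ep (lin s)) (- 1).
  exists (1 + x * - ep (alpha s)%:P).
    apply: nonunit_vunit1D => //; apply: nonunitM => //; first by right.
    by apply: subringN => //; apply: constP.
  by rewrite exprN1 invrK mulrDr mulr1 mulrA mulfV // mul1r -rmorphB.
have ord_prod (w : 'I_t -> int) :
    has_order (val_ring P) x (\prod_s ep (lin s) ^ w s) (- \sum_s w s).
  rewrite -sumrN; elim/big_ind2: _ => [|z c z' c'|s _].
  - by apply: has_order_vunit; apply: vunit1.
  - exact: has_orderM.
  - by rewrite -[w s]mul1r -mulNr mul1r; apply: has_orderXz.
(* The [m]-th power is a product of linear factors, whose orders in [x] are known; [y] itself need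
   not have one. *)
apply: (valring_root vP m_gt0).
have fE1 : e (tofrac f) = \prod_s ep (lin s) ^ 1.
  by rewrite fE; apply: eq_bigr => s _; rewrite expr1z.
have -> : (e (rootprod alpha v) * y ^+ i) ^+ m =
    (\prod_s ep (lin s) ^ v s) ^ m%:Z * (\prod_s ep (lin s) ^ 1) ^ i%:Z.
  by rewrite exprMn rootprodE -exprM mulnC exprM ym fE1.
have ordz := has_orderM vP x_neq0 (has_orderXz vP m%:Z (ord_prod v))
  (has_orderXz vP i%:Z (ord_prod (fun=> 1))).
apply/(has_order_mem vP x_neq0 x_nonunit ordz).
rewrite sumr_const card_ord !mulNr -opprD oppr_ge0 natz mulrC.
by rewrite [t%:Z * _]mulrC -PoszM.
Qed.

End Regular.

(** * Membership in the Weierstrass semigroup *)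

Section Semigroup.
Variables (n : nat) (Q : 'I_n -> place iota) (sg : 'I_n -> 'I_t) (l0 : 'I_n).
Hypothesis Qsg : forall l, centered (Q l) (sg l).
Hypothesis sg_inj : injective sg.
Hypothesis m_neq0 : m%:R != 0 :> k.
Implicit Type b : {ffun 'I_n -> int}.

(** The [l]-th term is the largest pole order at [alpha (sg l)] of a coefficient of [y ^+ i] for
    which the component has order at least [- b l] at [Q l]. *)
Definition floor_sum b (i : nat) : int := \sum_l ((b l + i%:Z) %/ m%:Z)%Z.
(** The exponent of [y] in the component that is leading at [Q l], since [- b l] is [m] times an
    order plus that exponent. *)
Definition residue b l : nat := `|((- b l) %% m%:Z)%Z|%N.

Let m_neq0z : m%:Z != 0. Proof. by rewrite eqz_nat -lt0n. Qed.

Lemma residueE b l : (residue b l)%:Z = ((- b l) %% m%:Z)%Z.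
Proof. by rewrite gez0_abs // modz_ge0. Qed.

Lemma ltn_residue b l : (residue b l < m)%N.
Proof. by rewrite -ltz_nat residueE ltz_pmod // ltz_nat. Qed.

Lemma residue_floor b l : m%:Z * ((b l + (residue b l)%:Z) %/ m%:Z)%Z = b l + (residue b l)%:Z.
Proof.
rewrite mulrC divzK // residueE; apply/dvdz_mod0P.
by rewrite modzDmr subrr mod0z.
Qed.

Lemma residue_eq b l (i : nat) (d : int) : (i < m)%N -> b l = m%:Z * d - i%:Z -> residue b l = i.
Proof.
move=> ltim bl; apply/eqP; rewrite -eqz_nat residueE bl opprB addrC -mulrN mulrC modzMDl.
by rewrite modz_small.
Qed.

(* The component of [z] of the degree that is leading at [Q l] has order [- b l]
   there and order at least [- b l'] at every [Q l']. *)
Lemma HhatP b : Hhat Q b <->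
  forall l, (residue b l * t)%N%:Z <= m%:Z * floor_sum b (residue b l).
Proof.
split.
  move=> [z [zQ z_neq0 def_b]] l; have [a def_z] := expansionP z.
  rewrite def_z in zQ z_neq0 def_b.
  have [v va] := orders_exist a; have a_neq0 := expansion_neq0 z_neq0.
  have nuQ l' i : leading a v (sg l') i -> b l' = m%:Z * - v i (sg l') - i%:Z.
    move=> lead; rewrite def_b ffunE (nu_leading (Qsg l') va lead).
    by rewrite opprD mulrN.
  have [i lead] := leading_exists v (sg l) a_neq0.
  have -> : residue b l = i by apply: (@residue_eq b l i _ _ (nuQ l i lead)); exact: ltn_ord.
  have [ai_neq0 _] := lead; have [N [D aiE]] := va _ ai_neq0.
  have [E [h [w w_prim]]] : exists (E : fieldType) (h : {rmorphism L -> E}) (w : E),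
      m.-primitive_root w.
    apply: exists_primitive_root; rewrite -(rmorph_nat (e \o (@tofrac {poly k} \o polyC))).
    by rewrite fmorph_eq0.
  have W := regular_pole_free l0 Qsg h w_prim m_neq0 zQ aiE.
  have := pole_free_bound aiE ai_neq0 W sg_inj (ltn_ord i).
  rewrite -[_ <= 0]lerN2 oppr0 opprD subr_ge0 -mulrN -sumrN => /le_trans; apply.
  rewrite ler_pM2l ?ltz_nat //; apply: ler_sum => l' _.
  have [i' lead'] := leading_exists v (sg l') a_neq0.
  rewrite lez_divRL ?ltz_nat // (nuQ _ _ lead'); case: lead' => _ /(_ i ai_neq0).
  by rewrite [- _ * _]mulrC !mulrN; lia.
move=> b_sum.
(* The orders at the [alpha (sg l)] are the least that [b] allows, and zero at the other roots;
   [sg_inj] leaves at most one term in each sum. Only degrees that occur as residues are used, those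
   for which a bound is assumed. *)
pose v (i : 'I_m) s := \sum_(l | sg l == s) - ((b l + i%:Z) %/ m%:Z)%Z.
pose a (i : 'I_m) := if [exists l, residue b l == i] then rootprod alpha (v i) else 0.
have va : orders a v.
  move=> i; rewrite /a; case: ifP => [_ _|]; last by rewrite eqxx.
  exists 1, 1; split; rewrite ?coprime1p //; do ?by move=> s; rewrite root1.
  by rewrite tofrac1 divr1 mulr1.
have vE i l : v i (sg l) = - ((b l + i%:Z) %/ m%:Z)%Z.
  rewrite /v (bigD1 l) //= big1 ?addr0 // => l' /andP[/eqP/sg_inj-> /negP].
  by rewrite eqxx.
pose i_ l := Ordinal (ltn_residue b l).
have lead l : leading a v (sg l) (i_ l).
  split=> [|i _].
    rewrite /a ifT; first exact: rootprod_neq0.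
    by apply/existsP; exists l.
  rewrite !vE !mulrN [i_ l : nat]/(residue b l) residue_floor.
  rewrite opprD addrNK -subr_ge0.
  suff : m%:Z * ((b l + i%:Z) %/ m%:Z)%Z <= b l + i%:Z by lia.
  by rewrite mulrC lez_floor.
exists (expansion a); split.
- apply: (regular_outside_sum (Q := Q)) => i _; rewrite /a; case: ifP => [/existsP[l /eqP li]|_].
    apply: (regular_monomial Qsg) => [s s_sg|].
      rewrite /v big1 // => l' /eqP ls.
      by have := s_sg l'; rewrite ls eqxx.
    have -> : \sum_s v i s = - floor_sum b i.
      by rewrite /v (exchange_big_dep xpredT) //= -sumrN; apply: eq_bigr => l' _;
         rewrite (bigD1 (sg l')) //= big1 ?addr0 // => s /andP[/eqP<-]; rewrite eqxx.
    by rewrite mulrN addrC subr_le0 -li b_sum.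
  by rewrite rmorph0 mul0r => P _; apply: subring0; case: (place_valring P).
- exact: (has_order_neq0 generator_neq0 (place_has_order_leading (Qsg l0) va (lead l0))).
apply/ffunP => l; rewrite ffunE (nu_leading (Qsg l) va (lead l)) vE mulrN.
rewrite [i_ l : nat]/(residue b l) residue_floor.
by rewrite opprD opprK addrK.
Qed.

End Semigroup.
End Places.
End Curve.

(** * Absolute and relative maximal elements *)

Section MaximalElements.
Variables (k F : fieldType) (iota : {rmorphism k -> F}) (n m t : nat).
Variable Q : 'I_n -> place iota.
Hypothesis m_gt0 : (0 < m)%N.
Hypothesis n_gt1 : (1 < n)%N.
Hypothesis HhatP : forall b, Hhat Q b <->
  forall l, (residue m b l * t)%N%:Z <= m%:Z * floor_sum m b (residue m b l).
Implicit Types (a b : {ffun 'I_n -> int}) (J : {set 'I_n}).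

Local Notation res := (residue m).
Local Notation G := (floor_sum m).

(* [threshold i] is the ceiling of [i * t / m]. *)
Definition threshold i : int := - ((- (i * t)%N%:Z) %/ m%:Z)%Z.
Definition outside_count J a i : nat := #|[set l | (l \notin J) && (res a l == i)]%SET|.

Let mz_neq0 : m%:Z != 0. Proof. by rewrite gt_eqF. Qed.

Lemma Hhat_threshold a : Hhat Q a <-> forall l, threshold (res a l) <= G a (res a l).
Proof.
have thr i x : (i%:Z <= m%:Z * x) = (- ((- i%:Z) %/ m%:Z)%Z <= x).
  by rewrite -[RHS]lerN2 opprK lez_divRL // mulNr lerN2 mulrC.
by split=> [/HhatP|] H; [|apply/HhatP]; move=> l; have := H l; rewrite thr.
Qed.

Lemma outside_countE J a i :
  (outside_count J a i)%:Z = \sum_l ((l \notin J) && (res a l == i))%:Z.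
Proof.
rewrite /outside_count -sum1_card big_mkcond /= -[LHS]natz natr_sum.
by apply: eq_bigr => l _; rewrite inE natz; case: (_ && _).
Qed.

(** Outside [J], [b] is strictly smaller than [a], and where [a l'] has residue [i] the number
    [a l' + i] is a multiple of [m], so the floor drops by at least one. *)
Lemma nablaJ_threshold J a b : nablaJ Q J a b ->
  forall l, l \in J ->
    threshold (res a l) + (outside_count J a (res a l))%:Z <= G a (res a l).
Proof.
move=> [/Hhat_threshold Hb bJ b_lt] l lJ.
have res_l : res b l = res a l by rewrite /residue bJ.
have := Hb l; rewrite res_l => Hbl; rewrite -lerBrDr; apply: le_trans Hbl _.
rewrite lerBrDr outside_countE -big_split /=; apply: ler_sum => l' _.
set i := res a l; have [l'J|l'J] /= := boolP (l' \in J); first by rewrite addr0 bJ.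
have lt_b := b_lt _ l'J; have [res_l'|_] := eqVneq (res a l') i; last first.
  rewrite addr0 lez_divRL //; apply: le_trans (lez_floor _ mz_neq0) _.
  by rewrite lerD2r ltW.
rewrite lezD1 ltz_divLR // mulrC -res_l' residue_floor //.
by rewrite ltrD2r.
Qed.

Lemma nablaJ_nonempty J a i l0 : l0 \in J -> (forall l, l \in J -> res a l = i) ->
  threshold i + (outside_count J a i)%:Z <= G a i -> nablaJ Q J a !=set0.
Proof.
move=> l0J resJ thr_le.
have ltim : (i < m)%N by rewrite -(resJ _ l0J) ltn_residue.
(* Outside [J] this is the largest integer below [a l] with residue [i]. A single threshold then
   remains, and the floor drops by one only where [a] has residue [i]. *)
pose b : {ffun 'I_n -> int} :=
  [ffun l => if l \in J then a l else m%:Z * ((a l - 1 + i%:Z) %/ m%:Z)%Z - i%:Z].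
have res_b l : res b l = i.
  have [lJ|lJ] := boolP (l \in J).
    by rewrite -(resJ l lJ) /residue ffunE lJ.
  by apply: (@residue_eq m m_gt0 n b l i _ ltim); rewrite ffunE (negPf lJ).
exists b; split.
- apply/Hhat_threshold => l; rewrite res_b.
  move: thr_le; rewrite -lerBrDr => /le_trans; apply.
  rewrite lerBlDr outside_countE -big_split /=; apply: ler_sum => l' _.
  rewrite ffunE; have [l'J|l'J] /= := boolP (l' \in J); first by rewrite addr0.
  rewrite addrNK mulKz //; set c := ((a l' + _) %/ _)%Z.
  have c_le : c * m%:Z <= a l' + i%:Z by apply: lez_floor.
  have [_|res_l'] := eqVneq (res a l') i.
    by rewrite -lerBlDr lez_divRL //; nia.
  rewrite addr0 lez_divRL //.
  suff : c * m%:Z != a l' + i%:Z by move: c_le; lia.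
  apply: contraNneq res_l' => c_eq; apply/eqP.
  by apply: (@residue_eq m m_gt0 n a l' i c ltim); rewrite mulrC c_eq addrK.
- by move=> l lJ; rewrite ffunE lJ.
- move=> l lJ; rewrite ffunE (negPf lJ).
  have := lez_floor (a l - 1 + i%:Z) mz_neq0; lia.
Qed.

Lemma outside_count_constant J a i : (forall l, res a l = i) ->
  outside_count J a i = (n - #|J|)%N.
Proof.
move=> res_a; rewrite /outside_count.
have -> : [set l | (l \notin J) && (res a l == i)]%SET = (~: J)%SET.
  by apply/setP => l; rewrite !inE res_a eqxx andbT.
by rewrite cardsCs finset.setCK card_ord.
Qed.

Lemma eq_set0_nonempty (T : Type) (A : set T) : A = set0 -> A !=set0 -> False.
Proof. by move=> -> []. Qed.

Let ex_distinct l : exists l', l' != l :> 'I_n.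
Proof.
case: n n_gt1 l => [|[|n']] // _ l.
by exists (lift l ord0); rewrite eq_sym neq_lift.
Qed.

Let proper1 l : [set l]%SET \proper [set: 'I_n]%SET.
Proof.
rewrite properE finset.subsetT /=; apply/subsetPn.
have [l' ll'] := ex_distinct l; exists l'; by rewrite ?inE.
Qed.

Let i0 : 'I_n := Ordinal (ltnW n_gt1).

(** If several residues occurred, the set [J] of coordinates with one of them would have outside
    count zero and a nonempty [nablaJ]. With one residue, the complement of a point has outside
    count 1, which excludes [G a i > threshold i]. *)
Lemma Gamma_hatP a : Gamma_hat Q a <->
  exists i, [/\ (i < m)%N, forall l, res a l = i & G a i = threshold i].
Proof.
split.
  move=> [[Ha nab] nabJ].
  have emptyJ J l : l \in J -> J \proper [set: 'I_n]%SET -> nablaJ Q J a = set0.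
    move=> lJ Jp; have [J2|J1] := leqP 2 #|J|; first exact: nabJ.
    have /cards1P[l' Jl'] : #|J| == 1%N.
      by rewrite eqn_leq -ltnS J1 card_gt0; apply/set0Pn; exists l.
    rewrite -subset0 => b bJ; have : nabla Q a b by exists l'; rewrite -Jl'.
    by rewrite nab.
  have res_const l l' : res a l = res a l'.
    apply/eqP/negPn/negP => ll'.
    pose J := [set x | res a x == res a l]%SET.
    have lJ : l \in J by rewrite inE.
    have Jp : J \proper [set: 'I_n]%SET.
      rewrite properE finset.subsetT /=; apply/subsetPn; exists l'; rewrite ?inE //.
      by rewrite eq_sym.
    apply: (eq_set0_nonempty (emptyJ J l lJ Jp)).
    apply: (nablaJ_nonempty (i := res a l) lJ); first by move=> x; rewrite inE => /eqP.
    have -> : outside_count J a (res a l) = 0%N.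
      apply/eqP; rewrite cards_eq0; apply/eqP/setP => x; rewrite !inE.
      by case: (_ == _).
    by rewrite addr0; move/Hhat_threshold: Ha.
  exists (res a i0); split=> [|l|]; [exact: ltn_residue|exact: res_const|].
  apply/eqP; rewrite eq_le andbC; move/Hhat_threshold: (Ha) => -> /=.
  have [l' l'0] := ex_distinct i0.
  rewrite leNgt; apply/negP => lt_thr.
  have Jp : (~: [set i0])%SET \proper [set: 'I_n]%SET.
    rewrite properE finset.subsetT /=; apply/subsetPn; exists i0; by rewrite !inE ?eqxx.
  have l'J : l' \in (~: [set i0])%SET by rewrite !inE.
  apply: (eq_set0_nonempty (emptyJ _ _ l'J Jp)).
  apply: (nablaJ_nonempty l'J (fun l _ => res_const l i0)).
  rewrite (outside_count_constant _ (fun l => res_const l i0)) cardsC1 card_ord.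
  have -> : (n - n.-1 = 1)%N by move: n_gt1; lia.
  by rewrite lezD1.
move=> [i [ltim res_a GE]].
have Ha : Hhat Q a by apply/Hhat_threshold => l; rewrite res_a GE.
have emptyJ J l : l \in J -> J \proper [set: 'I_n]%SET -> nablaJ Q J a = set0.
  move=> lJ /proper_card; rewrite cardsT card_ord => ltJn.
  rewrite -subset0 => b /nablaJ_threshold/(_ l lJ); rewrite res_a GE.
  by rewrite (outside_count_constant _ res_a); move: ltJn; lia.
split; first split=> //.
  by rewrite -subset0 => b [l]; rewrite (emptyJ _ l) ?inE.
move=> J Jp J2; have /set0Pn[l lJ] : J != finset.set0 by rewrite -card_gt0 (leq_trans _ J2).
exact: emptyJ lJ Jp.
Qed.

(** Singletons bound [G] from above and pairs from below. For different residues [l'] does not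
    count, so both bounds involve the same number and conflict; with one residue the counts are
    [n - 1] and [n - 2], which fixes [G]. *)
Lemma Lambda_hatP a : Lambda_hat Q a <->
  exists i, [/\ (i < m)%N, forall l, res a l = i & G a i = threshold i + (n%:Z - 2)].
Proof.
split.
  move=> [[Ha nab] nabJ].
  have upper l : G a (res a l) < threshold (res a l) + (outside_count [set l]%SET a (res a l))%:Z.
    rewrite ltNge; apply/negP => le_thr.
    have [||b b_l] := @nablaJ_nonempty [set l]%SET a (res a l) l _ _ le_thr.
    - by rewrite inE.
    - by move=> x; rewrite inE => /eqP->.
    have : nabla Q a b by exists l.
    by rewrite nab.
  have pair l l' : l != l' -> threshold (res a l) +
      (outside_count [set l; l']%SET a (res a l))%:Z <= G a (res a l).
    move=> ll'; have [Jp|Jfull] := boolP ([set l; l']%SET \proper [set: 'I_n]%SET).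
      have [|b bJ] := nabJ _ Jp; first by rewrite cards2 ll'.
      by apply: (nablaJ_threshold bJ); rewrite !inE eqxx.
    (* For [n = 2] the pair is the whole index set; the bound is then membership in the
       semigroup. *)
    have -> : outside_count [set l; l']%SET a (res a l) = 0%N.
      apply/eqP; rewrite cards_eq0; apply/eqP/setP => x; rewrite !inE.
      apply: contraNF Jfull => /andP[xJ _]; rewrite properE finset.subsetT /=.
      by apply/subsetPn; exists x; rewrite !inE.
    by rewrite addr0; move/Hhat_threshold: Ha.
  have res_const l l' : res a l = res a l'.
    apply/eqP/negPn/negP => ll'.
    have nll' : l != l' by apply: contraNneq ll' => ->.
    have := le_lt_trans (pair l l' nll') (upper l).
    rewrite ltrD2l ltz_nat ltnNge subset_leq_card //; apply/fintype.subsetP => x.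
    rewrite !inE => /andP[xl /eqP xr]; rewrite xr eqxx andbT negb_or xl /=.
    by apply: contraNneq ll' => <-; rewrite xr.
  exists (res a i0); split=> [|l|]; [exact: ltn_residue|exact: res_const|].
  have [l' l'0] := ex_distinct i0; rewrite eq_sym in l'0.
  have := pair _ _ l'0; have := upper i0.
  rewrite !(outside_count_constant _ (fun l => res_const l i0)) cards1 cards2 l'0.
  by move: n_gt1; lia.
move=> [i [ltim res_a GE]].
have Ha : Hhat Q a by apply/Hhat_threshold => l; rewrite res_a GE; move: n_gt1; lia.
split; first split=> //.
  rewrite -subset0 => b [l /nablaJ_threshold/(_ l)]; rewrite inE eqxx => /(_ isT).
  by rewrite res_a GE (outside_count_constant _ res_a) cards1; move: n_gt1; lia.
move=> J Jp J2; have /set0Pn[l lJ] : J != finset.set0 by rewrite -card_gt0 (leq_trans _ J2).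
apply: (nablaJ_nonempty lJ (fun l _ => res_a l)).
rewrite GE (outside_count_constant _ res_a).
have := proper_card Jp; rewrite cardsT card_ord; move: J2 n_gt1; lia.
Qed.

End MaximalElements.

(** * Explicit form of the maximal vectors *)

Section ThresholdSets.
Variables (n m t : nat) (rho : int).
Hypothesis m_gt0 : (0 < m)%N.
Implicit Types a : {ffun 'I_n -> int}.

Local Notation res := (residue m).
Local Notation G := (floor_sum m).

Let mz_neq0 : m%:Z != 0. Proof. by rewrite eqz_nat -lt0n. Qed.

Lemma threshold0 : threshold m t 0 = 0.
Proof. by rewrite /threshold mul0n oppr0 div0z. Qed.

(** Residues are taken of [- a l], so coordinates [m * j + i] have residue [m - i], and the ceiling
    of [(m - i) * t / m] is [t] minus a floor. *)
Lemma threshold_opp i : (i <= m)%N ->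
  threshold m t (m - i) = t%:Z - ((i * t) %/ m)%N%:Z.
Proof.
move=> leim; rewrite /threshold mulnBl -subzn ?leq_mul2r ?leim ?orbT // opprB.
by rewrite addrC PoszM -mulrN mulrC divzMDl // opprD opprK divz_nat.
Qed.

Definition affine_vectors : set {ffun 'I_n -> int} :=
  [set a | exists (i : nat) (j : {ffun 'I_n -> int}),
     [/\ (1 <= i <= m - 1)%N,
         \sum_(l < n) j l = t%:Z - n%:Z - ((i * t) %/ m)%N%:Z + rho &
         a = [ffun l => m%:Z * j l + i%:Z]]].

Definition linear_vectors : set {ffun 'I_n -> int} :=
  [set a | exists j : {ffun 'I_n -> int},
     \sum_(l < n) j l = rho /\ a = [ffun l => m%:Z * j l]].

Definition level_vectors : set {ffun 'I_n -> int} :=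
  [set a | exists i, [/\ (i < m)%N, forall l, res a l = i & G a i = threshold m t i + rho]].

Lemma level_vectorsE : level_vectors = affine_vectors `|` linear_vectors.
Proof.
apply/seteqP; split=> a.
  move=> [i [ltim res_a GE]].
  have aE l : a l = m%:Z * ((a l + i%:Z) %/ m%:Z)%Z - i%:Z.
    by have := residue_floor m_gt0 a l; rewrite res_a => ->; rewrite addrK.
  case: i ltim res_a GE aE => [|i] ltim res_a GE aE.
    right; exists [ffun l => (a l + 0%:Z) %/ m%:Z]%Z; split.
      by under eq_bigr do rewrite ffunE; rewrite -[LHS]/(G a 0) GE threshold0 add0r.
    by apply/ffunP => l; rewrite !ffunE {1}aE subr0.
  (* Rewriting [m * c - r] as [m * (c - 1) + (m - r)] lowers each of the [n] quotients by one,
     whence the term [- n]. *)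
  left; exists (m - i.+1)%N, [ffun l => ((a l + i.+1%:Z) %/ m%:Z)%Z - 1]; split.
  - by move: ltim; lia.
  - under eq_bigr do rewrite ffunE; rewrite big_split /= -[X in X + _]/(G a i.+1) GE.
    rewrite -[X in threshold _ _ X](subKn (ltnW ltim)) threshold_opp ?leq_subr //.
    rewrite sumrN sumr_const card_ord natz; ring.
  - apply/ffunP => l; rewrite !ffunE {1}aE -subzn 1?ltnW //; ring.
move=> [[i [j [i_le sum_j ->]]]|[j [sum_j ->]]].
  have le_im : (i <= m)%N by move: i_le; lia.
  have lt_im : (m - i < m)%N by move: i_le; lia.
  exists (m - i)%N; split=> // [l|].
    apply: (residue_eq m_gt0 (d := j l + 1)) => //.
    by rewrite ffunE -subzn //; ring.
  rewrite threshold_opp //.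
  have -> : G [ffun l => m%:Z * j l + i%:Z] (m - i)%N = \sum_l (j l + 1).
    apply: eq_bigr => l _; rewrite ffunE -subzn //.
    have -> : m%:Z * j l + i%:Z + (m%:Z - i%:Z) = m%:Z * (j l + 1) by ring.
    by rewrite mulKz.
  rewrite big_split /= sum_j sumr_const card_ord natz; ring.
exists 0%N; split=> // [l|].
  by apply: (residue_eq m_gt0 (d := j l)) => //; rewrite ffunE subr0.
rewrite threshold0 add0r -sum_j; apply: eq_bigr => l _.
by rewrite ffunE addr0 mulKz.
Qed.

Lemma positive_level_vectorsE : rho < n%:Z ->
  level_vectors `&` @positive_vectors n =
    [set a | exists (i : nat) (j : {ffun 'I_n -> nat}),
       [/\ (1 <= i <= m - 1)%N,
           \sum_(l < n) (j l)%:Z = t%:Z - n%:Z - ((i * t) %/ m)%N%:Z + rho &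
           a = [ffun l => m%:Z * (j l)%:Z + i%:Z]]].
Proof.
move=> rho_lt; rewrite level_vectorsE; apply/seteqP; split=> a.
  move=> [[[i [j [i_le sum_j ->]]]|[j [sum_j ->]]] a_gt0].
    have j_ge0 l : 0 <= j l.
      by have := a_gt0 l; rewrite ffunE; move: i_le m_gt0 => /andP[i1 i2] mp; nia.
    exists i, [ffun l => `|j l|%N]; split=> //.
      by rewrite -sum_j; apply: eq_bigr => l _; rewrite ffunE gez0_abs.
    by apply/ffunP => l; rewrite !ffunE gez0_abs.
  (* Positive multiples of [m] need [1 <= j l], so the sum of the [j l] is at least [n], which
     exceeds [rho]. *)
  have j_ge1 l : 1 <= j l.
    by have := a_gt0 l; rewrite ffunE; move: m_gt0; nia.
  have : n%:Z <= \sum_(l < n) j l.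
    have -> : n%:Z = \sum_(l < n) 1 by rewrite sumr_const card_ord natz.
    exact: ler_sum.
  by rewrite sum_j leNgt rho_lt.
move=> [i [j [i_le sum_j ->]]]; split.
  left; exists i, [ffun l => (j l)%:Z]; split=> //.
    by rewrite -sum_j; apply: eq_bigr => l _; rewrite ffunE.
  by apply/ffunP => l; rewrite !ffunE.
by move=> l; rewrite ffunE -PoszM -PoszD ltz_nat addn_gt0; move: i_le => /andP[-> _]; rewrite orbT.
Qed.

End ThresholdSets.

(** * Maximal elements at totally ramified places of the curve *)

Theorem proposition4p2 (Fq : finFieldType) (m t : nat)
    (hm : (2 <= m)%N) (ht : (2 <= t)%N)
    (hchar : forall p, p \in [pchar Fq] -> ~~ (p %| m)%N)
    (alpha : 'I_t -> Fq) (halpha : injective alpha)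
    (f : {poly Fq}) (hf : f = \prod_(s < t) ('X - (alpha s)%:P))
    (L : fieldExtType {fraction {poly Fq}}) (y : L)
    (hL : curve_function_field m f y)
    (n : nat) (hnt : (n <= t)%N) (hn : (2 <= n <= #|Fq|)%N)
    (Q : 'I_n -> place (curve_const L)) (hQ : injective Q)
    (hQf : forall l, exists2 r : Fq, root f r & over_zero (Q l) r)
    (Upsilon_hat Upsilon : set {ffun 'I_n -> int}) (rho : int)
    (hUpsilon :
      [/\ Upsilon_hat = Gamma_hat Q, Upsilon = Gamma Q & rho = 0] \/
      [/\ Upsilon_hat = Lambda_hat Q, Upsilon = Lambda Q & rho = n%:Z - 2]) :
  Upsilon_hat =
    [set a | exists (i : nat) (j : {ffun 'I_n -> int}),
       [/\ (1 <= i <= m - 1)%N,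
           \sum_(l < n) j l = t%:Z - n%:Z - ((i * t) %/ m)%N%:Z + rho &
           a = [ffun l => m%:Z * j l + i%:Z]]]
    `|` [set a | exists j : {ffun 'I_n -> int},
           \sum_(l < n) j l = rho /\ a = [ffun l => m%:Z * j l]]
  /\
  Upsilon =
    [set a | exists (i : nat) (j : {ffun 'I_n -> nat}),
       [/\ (1 <= i <= m - 1)%N,
           \sum_(l < n) (j l)%:Z = t%:Z - n%:Z - ((i * t) %/ m)%N%:Z + rho &
           a = [ffun l => m%:Z * (j l)%:Z + i%:Z]]].
Proof.
have m_gt0 : (0 < m)%N by apply: ltnW.
have /andP[n_gt1 _] := hn.
have m_neq0 : m%:R != 0 :> Fq.
  have [p pr_p chp] := finPcharP Fq.
  by rewrite -(dvdn_pcharf chp) hchar.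
have [ym0 y_full] := hL.
have ym : y ^+ m = in_alg L (tofrac (\prod_s ('X - (alpha s)%:P))) by rewrite ym0 hf.
have y_gen z : exists p, z = (map_poly (in_alg L) p).[y].
  by apply/Fadjoin1_polyP; rewrite y_full memvf.
have iotaE c : curve_const L c = in_alg L (tofrac c%:P) by [].
have /choice[sg Qsg] : forall l, exists s, centered alpha (in_alg L) (Q l) s.
  move=> l; have [r fr [P Pr QP]] := hQf l.
  have [s rs] : exists s, r = alpha s.
    move: fr; rewrite hf rootE horner_prod => /prodf_eq0[s _].
    by rewrite hornerXsubC subr_eq0 => /eqP; exists s.
  by exists s; rewrite /centered -rs; apply: (QP _ Pr).
(* Only one place is centered at a given root, so distinct places give distinct roots. *)
have sg_inj : injective sg.
  move=> l l' eq_sg; apply: hQ.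
  have Ql' := Qsg l'; rewrite -eq_sg in Ql'.
  exact: (centered_unique halpha m_gt0 ym y_gen iotaE (Qsg l) Ql').
have HP := HhatP halpha m_gt0 ym y_gen iotaE (Ordinal (ltnW n_gt1)) Qsg sg_inj m_neq0.
have [UE UpE rho_lt] : [/\ Upsilon_hat = @level_vectors n m t rho,
    Upsilon = Upsilon_hat `&` @positive_vectors n & rho < n%:Z].
  case: hUpsilon => -[-> -> ->]; split=> //; try by move: n_gt1; lia.
    apply/seteqP; split=> a.
      by move=> /(Gamma_hatP m_gt0 n_gt1 HP)[i [? ? ?]]; exists i; rewrite addr0.
    by move=> [i [? ?]]; rewrite addr0 => ?; apply/(Gamma_hatP m_gt0 n_gt1 HP); exists i.
  by apply/seteqP; split=> a /(Lambda_hatP m_gt0 n_gt1 HP).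
rewrite UpE UE; split; first exact: level_vectorsE.
exact: positive_level_vectorsE.
Qed.
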